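(* Let $\mathcal{G}$ be a strongly effective, ample, Hausdorff groupoid and let $K$ be a field. If for every open invariant subset $U\subseteq\mathcal{G}^{(0)}$ the groupoid $\mathcal{G}_{\mathcal{G}^{(0)}\setminus U}$ is locally contracting, then $A_K(\mathcal{G})$ is properly purely infinite.
   Context: Groupoids. For a groupoid $\mathcal{G}$ write $s(\alpha)=\alpha^{-1}\alpha$, $r(\alpha)=\alpha\alpha^{-1}$, so that $\alpha\beta$ is defined iff $s(\alpha)=r(\beta)$; $\mathcal{G}^{(0)}=\{\alpha^{-1}\alpha:\alpha\in\mathcal{G}\}$ is the unit space and $\mathrm{Iso}(\mathcal{G})=\{\alpha: s(\alpha)=r(\alpha)\}$. A topological groupoid is a groupoid with a topology making composition and inversion continuous. An open subset $B\subseteq\mathcal{G}$ is a bisection if $r|_B$ and $s|_B$ are homeomorphisms onto open subsets of $\mathcal{G}^{(0)}$. $\mathcal{G}$ is ample if it has a basis of compact open bisections. A subset $U\subseteq\mathcal{G}^{(0)}$ is invariant if $s(\alpha)\in U$ implies $r(\alpha)\in U$; then $\mathcal{G}_U:=s^{-1}(U)$ is a subgroupoid with unit space $U$ (given the relative topology). $\mathcal{G}$ is effective if the interior of $\mathrm{Iso}(\mathcal{G})$ is $\mathcal{G}^{(0)}$; it is strongly effective if $\mathcal{G}_V$ is effective for every nonempty closed invariant $V\subseteq\mathcal{G}^{(0)}$. An ample Hausdorff groupoid $\mathcal{G}$ is locally contracting if for every nonempty compact open $V\subseteq\mathcal{G}^{(0)}$ there is a compact open bisection $B\subseteq\mathcal{G}$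 with $s(B)\subsetneq r(B)\subseteq V$. Steinberg algebra. For an ample Hausdorff groupoid $\mathcal{G}$ and a field $K$, $A_K(\mathcal{G})$ is the $K$-algebra of locally constant, compactly supported functions $\mathcal{G}\to K$ with pointwise addition and convolution $(fg)(\alpha)=\sum_{r(\beta)=r(\alpha)}f(\beta)g(\beta^{-1}\alpha)$. Infiniteness in rings. For a (not necessarily unital) ring $R$, $a\in M_m(R)$, $b\in M_n(R)$: $a\oplus b$ is the block diagonal matrix $\mathrm{diag}(a,b)$, and $a\precsim b$ means $a=xby$ for some $x\in M_{m,n}(R)$, $y\in M_{n,m}(R)$. A nonzero $a\in R$ is properly infinite if $a\oplus a\precsim a$. $R$ is properly purely infinite if every nonzero element of $R$ is properly infinite. *)

(* Defs.v *)
From HB Require Import structures.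
From mathcomp Require Import all_boot all_algebra.
From mathcomp Require Import all_classical topology.

Set Implicit Arguments.
Unset Strict Implicit.
Unset Printing Implicit Defensive.

Import GRing.Theory.

Local Open Scope classical_set_scope.

(* The product of a groupoid is encoded by a total function [gmul] whose value
   on a pair (a, b) is meaningful only when the source a^-1 a of a equals the
   range b b^-1 of b; every axiom is restricted to such composable pairs. *)
HB.mixin Record Topological_isGroupoid G of Topological G := {
  gmul : G -> G -> G ;
  ginv : G -> G ;
  ginvK : involutive ginv ;
  gsource_mul : forall a b, gmul (ginv a) a = gmul b (ginv b) ->
    gmul (ginv (gmul a b)) (gmul a b) = gmul (ginv b) b ;
  grange_mul : forall a b, gmul (ginv a) a = gmul b (ginv b) ->
    gmul (gmul a b) (ginv (gmul a b)) = gmul a (ginv a) ;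
  gmulA : forall a b c, gmul (ginv a) a = gmul b (ginv b) ->
    gmul (ginv b) b = gmul c (ginv c) ->
    gmul a (gmul b c) = gmul (gmul a b) c ;
  gmulKV : forall a b, gmul (ginv a) a = gmul b (ginv b) ->
    gmul (ginv a) (gmul a b) = b ;
  gmulVK : forall a b, gmul (ginv a) a = gmul b (ginv b) ->
    gmul (gmul a b) (ginv b) = a ;
  ginv_continuous : continuous ginv ;
  gmul_continuous :
    {within [set p : G * G | gmul (ginv p.1) p.1 = gmul p.2 (ginv p.2)],
      continuous (fun p : G * G => gmul p.1 p.2)}
}.

#[short(type="topGroupoidType")]
HB.structure Definition TopGroupoid :=
  { G of Topological G & Topological_isGroupoid G }.

Section Relative.
Context {X : topologicalType}.
Implicit Types A U : set X.

Definition open_in A U := U `<=` A /\ open (U : set (subspace A)).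

Definition closed_in A U := U `<=` A /\ closed (U : set (subspace A)).

Definition homeomorphism_between (A C : set X) (f : X -> X) :=
  exists g : X -> X,
    [/\ f @` A = C, {in A, cancel f g},
        {within A, continuous f} & {within C, continuous g}].

End Relative.

Section Groupoid.
Context {G : topGroupoidType}.
Implicit Types (a b c : G) (B U V : set G).

Definition gsource a := gmul (ginv a) a.
Definition grange a := gmul a (ginv a).

Definition units : set G := range gsource.

Definition isotropy : set G := [set a | gsource a = grange a].

Definition bisection B :=
  [/\ open B,
      exists2 U, open_in units U & homeomorphism_between B U grange &
      exists2 U, open_in units U & homeomorphism_between B U gsource].

Definition ginvariant U :=
  U `<=` units /\ (forall a, U (gsource a) -> U (grange a)).

Lemma gsourceV a : gsource (ginv a) = grange a.
Proof. by rewrite /gsource /grange ginvK. Qed.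

Lemma grangeV a : grange (ginv a) = gsource a.
Proof. by rewrite /gsource /grange ginvK. Qed.

Lemma gsourceM a b : gsource a = grange b -> gsource (gmul a b) = gsource b.
Proof. exact: gsource_mul. Qed.

Lemma grangeM a b : gsource a = grange b -> grange (gmul a b) = grange a.
Proof. exact: grange_mul. Qed.

Lemma gmulK a b : gsource a = grange b -> gmul (ginv a) (gmul a b) = b.
Proof. exact: gmulKV. Qed.

Lemma gmulVKl a b : grange a = grange b -> gmul a (gmul (ginv a) b) = b.
Proof. by rewrite -gsourceV => /gmulK; rewrite ginvK. Qed.

Lemma ginvM a b : gsource a = grange b ->
  ginv (gmul a b) = gmul (ginv b) (ginv a).
Proof.
move=> ab; pose c := gmul a b.
have cb : gmul c (ginv b) = a by exact: gmulVK.
have ca : gsource c = grange (ginv b) by rewrite gsourceM// grangeV.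
have bc : grange (ginv c) = gsource c by rewrite grangeV.
have e : gmul (ginv c) a = ginv b by rewrite -cb gmulK.
have ca' : gsource (ginv c) = grange a by rewrite gsourceV grangeM.
by rewrite -e; apply/esym; exact: gmulVK.
Qed.

Lemma gmul_cvg (T : Type) (F : set_system T) (FF : Filter F) (f g : T -> G) a b :
  gsource a = grange b ->
  (\forall t \near F, gsource (f t) = grange (g t)) ->
  f @ F --> a -> g @ F --> b ->
  (fun t => gmul (f t) (g t)) @ F --> gmul a b.
Proof.
move=> ab fg fa gb W nW.
have /subspace_continuousP/(_ (a, b) ab W nW) := @gmul_continuous G.
rewrite /= !nbhs_simpl/= => nW'.
have := cvg_pair fa gb nW'; rewrite !nbhs_simpl /= => h.
by apply: filterS2 (h _ _ _) fg => t; apply.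
Qed.

Lemma grange_continuous : continuous (grange : G -> G).
Proof.
move=> a; apply: gmul_cvg; first by rewrite grangeV.
- by apply: nearW => b; rewrite grangeV.
- exact: cvg_id.
- exact: ginv_continuous.
Qed.

Lemma gsource_continuous : continuous (gsource : G -> G).
Proof.
move=> a; apply: gmul_cvg; first by rewrite gsourceV.
- by apply: nearW => b; rewrite gsourceV.
- exact: ginv_continuous.
- exact: cvg_id.
Qed.

Lemma ginvariant_setD U : ginvariant U -> ginvariant (units `\` U).
Proof.
move=> [_ iU]; split=> [a [] //|a [_ nUa]]; split.
  by exists (ginv a) => //; exact: gsourceV.
by apply: contra_not nUa; rewrite -gsourceV => /iU; rewrite grangeV.
Qed.

Definition ample :=
  exists2 Bs : set (set G), basis Bs &
    Bs `<=` [set B | compact B /\ bisection B].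

Definition effective := isotropy^° = units.

Definition locally_contracting :=
  forall V, V !=set0 -> compact V -> open_in units V ->
    exists B, [/\ compact B, bisection B,
      gsource @` B `<` grange @` B & grange @` B `<=` V].

End Groupoid.
Arguments units : clear implicits.
Arguments isotropy : clear implicits.
Arguments ample : clear implicits.
Arguments effective : clear implicits.
Arguments locally_contracting : clear implicits.

(* The subgroupoid s^-1(V) with the subspace topology, as a groupoid in its
   own right; [insubd a x] is x when x lies in s^-1(V), in particular on
   composable pairs, and a otherwise. *)
Definition reduction (G : topGroupoidType) (V : set G) (iV : ginvariant V) :
  Type := set_type (gsource @^-1` V).

Section Reduction.
Context {G : topGroupoidType} {V : set G} (iV : ginvariant V).
Local Notation H := (reduction iV).

HB.instance Definition _ := Topological.copy H (set_type (gsource @^-1` V)).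

Definition reduction_mul (a b : H) : H := insubd a (gmul (val a) (val b)).

Definition reduction_inv (a : H) : H := insubd a (ginv (val a)).

Lemma reductionP (a : H) : V (gsource (val a)).
Proof. exact: set_valP a. Qed.

Lemma val_reduction_inv a : val (reduction_inv a) = ginv (val a).
Proof.
rewrite /reduction_inv val_insubd ifT//; apply: mem_set => /=.
by rewrite gsourceV; apply: iV.2; exact: reductionP.
Qed.

Lemma val_reduction_mul a b : gsource (val a) = grange (val b) ->
  val (reduction_mul a b) = gmul (val a) (val b).
Proof.
move=> ab; rewrite /reduction_mul val_insubd ifT//; apply: mem_set => /=.
by rewrite gsourceM//; exact: reductionP.
Qed.

Lemma val_reduction_source a :
  val (reduction_mul (reduction_inv a) a) = gsource (val a).
Proof.
by rewrite val_reduction_mul val_reduction_inv ?gsourceV.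
Qed.

Lemma val_reduction_range a :
  val (reduction_mul a (reduction_inv a)) = grange (val a).
Proof.
by rewrite val_reduction_mul val_reduction_inv ?grangeV.
Qed.

Lemma reduction_composable a b :
  reduction_mul (reduction_inv a) a = reduction_mul b (reduction_inv b) ->
  gsource (val a) = grange (val b).
Proof. by move=> /(congr1 val); rewrite val_reduction_source val_reduction_range. Qed.

Lemma reduction_invK : involutive reduction_inv.
Proof. by move=> a; apply: val_inj; rewrite !val_reduction_inv ginvK. Qed.

Lemma reduction_source_mul a b :
  reduction_mul (reduction_inv a) a = reduction_mul b (reduction_inv b) ->
  reduction_mul (reduction_inv (reduction_mul a b)) (reduction_mul a b) =
  reduction_mul (reduction_inv b) b.
Proof.
move=> /reduction_composable ab; apply: val_inj.
by rewrite !val_reduction_source val_reduction_mul// gsourceM.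
Qed.

Lemma reduction_range_mul a b :
  reduction_mul (reduction_inv a) a = reduction_mul b (reduction_inv b) ->
  reduction_mul (reduction_mul a b) (reduction_inv (reduction_mul a b)) =
  reduction_mul a (reduction_inv a).
Proof.
move=> /reduction_composable ab; apply: val_inj.
by rewrite !val_reduction_range val_reduction_mul// grangeM.
Qed.

Lemma reduction_mulA a b c :
  reduction_mul (reduction_inv a) a = reduction_mul b (reduction_inv b) ->
  reduction_mul (reduction_inv b) b = reduction_mul c (reduction_inv c) ->
  reduction_mul a (reduction_mul b c) = reduction_mul (reduction_mul a b) c.
Proof.
move=> /reduction_composable ab /reduction_composable bc; apply: val_inj.
rewrite !val_reduction_mul ?gsourceM ?grangeM//; exact: gmulA.
Qed.

Lemma reduction_mulKV a b :
  reduction_mul (reduction_inv a) a = reduction_mul b (reduction_inv b) ->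
  reduction_mul (reduction_inv a) (reduction_mul a b) = b.
Proof.
move=> /reduction_composable ab; apply: val_inj.
rewrite !val_reduction_mul ?val_reduction_inv ?gsourceV ?grangeM//.
exact: gmulKV.
Qed.

Lemma reduction_mulVK a b :
  reduction_mul (reduction_inv a) a = reduction_mul b (reduction_inv b) ->
  reduction_mul (reduction_mul a b) (reduction_inv b) = a.
Proof.
move=> /reduction_composable ab; apply: val_inj.
rewrite !val_reduction_mul ?val_reduction_inv ?grangeV ?gsourceM//.
exact: gmulVK.
Qed.

Lemma val_reduction_continuous : continuous (val : H -> G).
Proof. exact: initial_continuous. Qed.

Lemma reduction_inv_continuous : continuous reduction_inv.
Proof.
apply: continuous_comp_initial => a.
have -> : set_val \o reduction_inv = (@ginv G) \o (val : H -> G).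
  by apply/funext => b; exact: val_reduction_inv.
apply: continuous_comp; first exact: val_reduction_continuous.
exact: ginv_continuous.
Qed.

Lemma reduction_mul_continuous :
  {within [set p : H * H | reduction_mul (reduction_inv p.1) p.1 =
                           reduction_mul p.2 (reduction_inv p.2)],
    continuous (fun p : H * H => reduction_mul p.1 p.2)}.
Proof.
apply: continuous_comp_initial; apply/subspace_continuousP => -[a b] /= ab.
have ab' := reduction_composable ab.
rewrite /= [set_val _](val_reduction_mul ab').
apply: (@cvg_trans _
    ((fun p : H * H => gmul (val p.1) (val p.2)) @
      within [set p : H * H | reduction_mul (reduction_inv p.1) p.1 =
                              reduction_mul p.2 (reduction_inv p.2)]
        (nbhs (a, b)))).
  apply: fmap_within_eq => -[c d] /set_mem/= /reduction_composable cd.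
  by rewrite -val_reduction_mul.
apply: gmul_cvg => //.
- rewrite near_withinE; near=> p; exact: reduction_composable.
- apply: cvg_within_filter; apply: (cvg_comp fst val); first exact: cvg_fst.
  exact: val_reduction_continuous.
- apply: cvg_within_filter; apply: (cvg_comp snd val); first exact: cvg_snd.
  exact: val_reduction_continuous.
Unshelve. all: by end_near. Qed.

HB.instance Definition _ := Topological_isGroupoid.Build H
  reduction_invK reduction_source_mul reduction_range_mul reduction_mulA
  reduction_mulKV reduction_mulVK reduction_inv_continuous
  reduction_mul_continuous.

End Reduction.

Definition strongly_effective (G : topGroupoidType) :=
  forall (V : set G) (iV : ginvariant V),
    V !=set0 -> closed_in (units G) V -> effective (reduction iV).

HB.mixin Record TopGroupoid_isAmpleHausdorff G of TopGroupoid G := {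
  ampleP : ample G ;
  groupoid_hausdorff : hausdorff_space G
}.

#[short(type="ampleHausdorffGroupoidType")]
HB.structure Definition AmpleHausdorffGroupoid :=
  { G of TopGroupoid G & TopGroupoid_isAmpleHausdorff G }.

HB.mixin Record Zmodule_isNonUnitalRing R of GRing.Zmodule R := {
  nmul : R -> R -> R ;
  nmulA : associative nmul ;
  nmulDl : left_distributive nmul +%R ;
  nmulDr : right_distributive nmul +%R
}.

#[short(type="nonUnitalRingType")]
HB.structure Definition NonUnitalRing :=
  { R of GRing.Zmodule R & Zmodule_isNonUnitalRing R }.

Local Open Scope ring_scope.

Section ProperlyPurelyInfinite.
Context {R : nonUnitalRingType}.

Definition nmulmx m n p (A : 'M[R]_(m, n)) (B : 'M[R]_(n, p)) : 'M[R]_(m, p) :=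
  \matrix_(i, k) \sum_j nmul (A i j) (B j k).

Definition mxdsum m n (a : 'M[R]_m) (b : 'M[R]_n) : 'M[R]_(m + n) :=
  block_mx a 0 0 b.

Definition mxprecsim m n (a : 'M[R]_m) (b : 'M[R]_n) :=
  exists (x : 'M[R]_(m, n)) (y : 'M[R]_(n, m)), a = nmulmx (nmulmx x b) y.

(* An element of R is viewed as a 1 x 1 matrix. *)
Definition properly_infinite (a : R) :=
  a != 0 /\
  mxprecsim (mxdsum (const_mx a : 'M_1) (const_mx a : 'M_1)) (const_mx a : 'M_1).

End ProperlyPurelyInfinite.

Definition properly_purely_infinite (R : nonUnitalRingType) :=
  forall a : R, a != 0 -> properly_infinite a.

Section AmpleHausdorff.
Context {G : ampleHausdorffGroupoidType}.
Implicit Types (a b c : G) (B C : set G).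

Lemma compact_bisection_cover C : compact C ->
  exists2 Bs : seq (set G),
    (forall B, B \in Bs -> compact B /\ bisection B) &
    C `<=` [set a | exists2 B, B \in Bs & B a].
Proof.
have [Bs [_ Bsb] BsP] := ampleP (s := G).
have [[x Cx]|/set0P/negP/negPn/eqP->] := pselect (C !=set0); last first.
  by exists [::].
pose T : ptopologicalType :=
  HB.pack (AmpleHausdorffGroupoid.sort G) (isPointed.Build G x).
move=> cC; have : @cover_compact T C by rewrite -compact_cover.
move=> /(_ _ [set B | compact B /\ bisection B] id); case=> [B [_ []]//|a Ca|D DP CD].
  have [B [BB Ba] _] := Bsb a setT filterT.
  by exists B => //; exact: BsP.
exists (finmap.enum_fset D) => [B /DP|a /CD [B DB Ba]]; first by rewrite inE.
by exists B.
Qed.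

Lemma bisection_range_inj B : bisection B -> {in B &, injective (grange : G -> G)}.
Proof. by case=> _ [U _ [g [_ gK _ _]]] _; exact: can_in_inj gK. Qed.

Lemma bisection_source_inj B : bisection B -> {in B &, injective (gsource : G -> G)}.
Proof. by case=> _ _ [U _ [g [_ gK _ _]]]; exact: can_in_inj gK. Qed.

Lemma finite_fibre (f : G -> G) C x :
  (forall B, bisection B -> {in B &, injective f}) ->
  compact C -> finite_set (C `&` [set a | f a = x]).
Proof.
move=> finj /compact_bisection_cover[Bs BsP CB].
apply: (@sub_finite_set _ _
    (\bigcup_(B in [set` Bs]) (B `&` [set a | f a = x]))).
  by move=> a [/CB[B BB Ba] /= fa]; exists B.
apply: bigcup_finite => [|B /= /BsP[_ bB]]; first exact: finite_seq.
have [[a [Ba fa]]|/set0P/negP/negPn/eqP->//] :=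
  pselect (B `&` [set a | f a = x] !=set0).
apply: (@sub_finite_set _ _ [set a]) => // b [Bb /= fb].
by apply: (finj _ bB); rewrite ?inE// fa fb.
Qed.

Lemma finite_range_fibre C x :
  compact C -> finite_set (C `&` [set a | grange a = x]).
Proof. by apply: finite_fibre => B; exact: bisection_range_inj. Qed.

Lemma finite_source_fibre C x :
  compact C -> finite_set (C `&` [set a | gsource a = x]).
Proof. by apply: finite_fibre => B; exact: bisection_source_inj. Qed.

Context {K : fieldType}.
Implicit Types f g h : G -> K.

Definition locally_constant f := forall a, \forall b \near a, f b = f a.

Definition gsupp f := closure [set a | f a != 0].

(* For f in the Steinberg algebra only finitely many terms are nonzero, since
   the range map has finite fibres on the compact support of f; [\sum_(b \in _)]
   is the sum over the finitely many indices with a nonzero term. *)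
Definition convolution f g a : K :=
  \sum_(b \in [set b | grange b = grange a]) f b * g (gmul (ginv b) a).

Definition steinberg_pred : {pred G -> K^o} :=
  [pred f | `[< locally_constant f /\ compact (gsupp f) >]].

Lemma locally_constant_supp f : locally_constant f ->
  open [set a | f a != 0] /\ closed [set a | f a != 0].
Proof.
move=> lf; split=> [|].
  by rewrite openE => a /= fa; apply: filterS (lf a) => b /= ->.
by move=> a fa /=; have [b [/= fb <-]] := fa _ (lf a).
Qed.

Lemma steinbergP f : f \in steinberg_pred <->
  locally_constant f /\ compact [set a | f a != 0].
Proof.
suff e : locally_constant f -> gsupp f = [set a | f a != 0].
  by split=> [/asboolP[lf cf]|[lf cf]]; last apply/asboolP; split=> //;
    [rewrite -e|rewrite e].
by move=> /locally_constant_supp[_ /closure_id].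
Qed.

Lemma steinberg_submod_closed : submod_closed steinberg_pred.
Proof.
split=> [|k f g /steinbergP[lf cf] /steinbergP[lg cg]]; apply/steinbergP.
  split=> [a|]; first exact: nearW.
  rewrite (_ : [set _ | _] = set0); first exact: compact0.
  by apply/seteqP; split => // a /=; rewrite eqxx.
have kE (c : G) : (k *: f + g) c = k * f c + g c by [].
have lfg : locally_constant (k *: f + g).
  move=> a; near=> b; rewrite !kE; congr (_ * _ + _).
    by near: b; exact: lf.
  by near: b; exact: lg.
split=> //; apply: (subclosed_compact _ (compactU cf cg)).
  exact: (locally_constant_supp lfg).2.
move=> a /=; rewrite kE.
have [->|fa] := eqVneq (f a) 0; last by left.
by rewrite mulr0 add0r; right.
Unshelve. all: by end_near. Qed.

Lemma fun_addE f g a : (f + g) a = f a + g a.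
Proof. by []. Qed.

Lemma finite_supp_range f a : f \in steinberg_pred ->
  finite_set [set b | f b != 0 /\ grange b = grange a].
Proof. by move=> /steinbergP[_ cf]; exact: finite_range_fibre. Qed.

Lemma convolutionE (X : set G) f g a : X `<=` [set b | grange b = grange a] ->
  (forall b, grange b = grange a -> f b != 0 -> g (gmul (ginv b) a) != 0 -> X b) ->
  convolution f g a = \sum_(b \in X) f b * g (gmul (ginv b) a).
Proof.
move=> Xa fX; apply/esym/fsbig_widen => // b [/= ba nXb].
apply/eqP; rewrite mulf_eq0.
apply: contra_notT nXb; rewrite negb_or => /andP[fb gb]; exact: fX.
Qed.

Lemma convolutionDl f1 f2 g : f1 \in steinberg_pred -> f2 \in steinberg_pred ->
  convolution (f1 + f2) g = convolution f1 g + convolution f2 g.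
Proof.
move=> f1P f2P; apply/funext => a; rewrite [RHS]fun_addE.
pose X : set G := [set b | f1 b != 0 /\ grange b = grange a] `|`
         [set b | f2 b != 0 /\ grange b = grange a].
have Xa : X `<=` [set b | grange b = grange a] by move=> b [] [].
have finX : finite_set X by rewrite finite_setU; split; exact: finite_supp_range.
rewrite !(convolutionE Xa)//.
- rewrite -fsbig_split//; apply: eq_fsbigr => b _; exact: mulrDl.
- by move=> b ba fb _; right.
- by move=> b ba fb _; left.
- move=> b ba; rewrite fun_addE => fb _.
  have [f10|?] := eqVneq (f1 b) 0; last by left.
  by right; split => //; move: fb; rewrite f10 add0r.
Qed.

Lemma convolutionDr f g1 g2 : f \in steinberg_pred ->
  convolution f (g1 + g2) = convolution f g1 + convolution f g2.
Proof.
move=> fP; apply/funext => a; rewrite [RHS]fun_addE.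
pose X : set G := [set b | f b != 0 /\ grange b = grange a].
have Xa : X `<=` [set b | grange b = grange a] by move=> b [].
have finX : finite_set X by exact: finite_supp_range.
rewrite !(convolutionE Xa)//.
rewrite -fsbig_split//; apply: eq_fsbigr => b _; exact: mulrDr.
Qed.

Lemma convolutionZl (k : K) f g :
  convolution (k *: (f : G -> K^o)) g =
  k *: (convolution f g : G -> K^o).
Proof.
apply/funext => a; rewrite [RHS]mulr_fsumr.
by apply: eq_fsbigr => b _; rewrite mulrA.
Qed.

Lemma convolutionZr (k : K) f g :
  convolution f (k *: (g : G -> K^o)) =
  k *: (convolution f g : G -> K^o).
Proof.
apply/funext => a; rewrite [RHS]mulr_fsumr.
by apply: eq_fsbigr => b _; rewrite mulrCA.
Qed.

Lemma locally_constant_convolution_bisection B f g : bisection B ->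
  locally_constant f -> compact [set a | f a != 0] -> locally_constant g ->
  [set a | f a != 0] `<=` B -> locally_constant (convolution f g).
Proof.
move=> bB lf cf lg fB a.
have finj := bisection_range_inj bB.
have [[b [fb ba]]|nb] := pselect (exists b, f b != 0 /\ grange b = grange a).
  have [_ [U [Uu /open_subspaceP[O oO OU]] [t [BU tK _ ct]]] _] := bB.
  have Ua : U (grange a) by rewrite -BU -ba; exists b => //; exact: fB.
  have Oa : O (grange a).
    by have [] : (O `&` units G) (grange a) by rewrite OU; split=> //; exact: Uu.
  have tb : t (grange a) = b by rewrite -ba tK// inE; exact: fB.
  have runit c : units G (grange c).
    by exists (ginv c) => //; exact: gsourceV.
  have nU : \forall c \near a, U (grange c).
    have := @grange_continuous G a O (open_nbhs_nbhs (conj oO Oa)).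
    rewrite nbhs_simpl/=; apply: filterS => c Oc.
    by have [] : (U `&` units G) (grange c) by rewrite -OU.
  have ctr : (t \o grange) @ a --> b.
    rewrite -tb; move/subspace_continuousP: ct => /(_ _ Ua) ct W nW.
    have := ct W nW; rewrite /= !nbhs_simpl/= /within/= => nW'.
    have := @grange_continuous G a _ nW'; rewrite nbhs_simpl/=.
    by apply: filterS2 nU => c Uc; apply.
  have tP c : U (grange c) -> B (t (grange c)) /\ grange (t (grange c)) = grange c.
    by rewrite -BU => -[d Bd dc]; rewrite -dc tK ?inE.
  have conv1 c : U (grange c) -> convolution f g c =
      f (t (grange c)) * g (gmul (ginv (t (grange c))) c).
    move=> Uc; have [Bt tc] := tP _ Uc.
    rewrite (@convolutionE [set t (grange c)]) ?fsbig_set1//.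
      by move=> d ->.
    move=> d dc fd _ /=; apply: finj; rewrite ?inE ?dc ?tc//.
    exact: fB.
  rewrite (conv1 a)// tb.
  have cta : (fun c => gmul (ginv (t (grange c))) c) @ a --> gmul (ginv b) a.
    apply: gmul_cvg; first by rewrite gsourceV.
    - near=> c; rewrite gsourceV; apply: (tP _ _).2.
      by near: c.
    - apply: (@cvg_comp _ _ _ (t \o grange) ginv _ (nbhs b)) => //.
      exact: ginv_continuous.
    - exact: cvg_id.
  near=> c; rewrite conv1; last by near: c.
  congr (_ * _); near: c.
    exact: (ctr _ (lf b)).
  exact: (cta _ (lg _)).
have cr : closed (grange @` [set b | f b != 0]).
  apply: compact_closed; first exact: groupoid_hausdorff.
  apply: continuous_compact => //; apply: continuous_subspaceT.
  exact: grange_continuous.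
have conv0 c : ~ (grange @` [set b | f b != 0]) (grange c) ->
    convolution f g c = 0.
  move=> nc; rewrite (@convolutionE set0) ?fsbig_set0// => d dc fd _.
  by apply: nc; exists d.
rewrite conv0; last by move=> [b fb ba]; apply: nb; exists b.
have : nbhs (grange a) (~` (grange @` [set b | f b != 0])).
  apply: open_nbhs_nbhs; split; first exact: closed_openC.
  by move=> [b fb ba]; apply: nb; exists b.
move=> /(@grange_continuous G a); rewrite nbhs_simpl/=.
by apply: filterS => c nc; exact: conv0.
Unshelve. all: by end_near. Qed.

Definition restrict_clopen (D : set G) f : G -> K :=
  fun a => if a \in D then f a else 0.

Lemma steinberg_restrict D f : clopen D ->
  f \in steinberg_pred -> restrict_clopen D f \in steinberg_pred.
Proof.
move=> [oD cD] /steinbergP[lf cf]; apply/steinbergP.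
have lr : locally_constant (restrict_clopen D f).
  move=> a; have [Da|nDa] := pselect (D a).
    near=> b; rewrite /restrict_clopen !mem_set//; near: b; first exact: lf.
    exact: open_nbhs_nbhs.
  near=> b; rewrite /restrict_clopen !memNset//; near: b.
  apply: open_nbhs_nbhs; split => //; exact: closed_openC.
split => //; apply: (subclosed_compact _ cf).
  exact: (locally_constant_supp lr).2.
by move=> a /=; rewrite /restrict_clopen; case: ifP => //; rewrite eqxx.
Unshelve. all: by end_near. Qed.

Lemma locally_constant_convolution f g :
  f \in steinberg_pred -> g \in steinberg_pred ->
  locally_constant (convolution f g).
Proof.
move=> fP /steinbergP[lg _].
have [Bs BsP fBs] := compact_bisection_cover ((steinbergP f).1 fP).2.
elim: Bs f fP BsP fBs => [|B Bs IH] f fP BsP fBs.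
  move=> a; apply: nearW => b.
  have conv0 c : convolution f g c = 0.
    rewrite (@convolutionE set0) ?fsbig_set0// => d _ fd _.
    by have [] := fBs _ fd.
  by rewrite !conv0.
have [cB bB] := BsP B (mem_head _ _).
have clB : clopen B.
  by split; [case: bB|exact: (compact_closed groupoid_hausdorff cB)].
have clNB : clopen (~` B) by split; [exact: closed_openC clB.2|exact: open_closedC clB.1].
have f1P := steinberg_restrict clB fP.
have f2P := steinberg_restrict clNB fP.
have -> : f = restrict_clopen B f + restrict_clopen (~` B) f.
  apply/funext => a; rewrite fun_addE /restrict_clopen in_setC.
  by case: ifP => _; rewrite ?addr0 ?add0r.
rewrite convolutionDl// => a; near=> b; rewrite !fun_addE; congr (_ + _); near: b.
  have [l c] := (steinbergP _).1 f1P.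
  apply: (locally_constant_convolution_bisection bB l c lg).
  by move=> b /=; rewrite /restrict_clopen; case: ifPn; rewrite ?inE// eqxx.
apply: (IH _ f2P) => [C CB|b /=].
  by apply: BsP; rewrite inE CB orbT.
rewrite /restrict_clopen; case: ifPn; rewrite ?eqxx// inE => nBb fb.
have [C + Cb] := fBs _ fb; rewrite inE => /predU1P[CB|CBs]; last by exists C.
by exfalso; apply: nBb; rewrite -CB.
Unshelve. all: by end_near. Qed.

Lemma steinberg_convolution f g :
  f \in steinberg_pred -> g \in steinberg_pred ->
  convolution f g \in steinberg_pred.
Proof.
move=> fP gP; have lc := locally_constant_convolution fP gP.
apply/steinbergP; split => //.
have [[lf cf] [lg cg]] := ((steinbergP f).1 fP, (steinbergP g).1 gP).
pose G2 : set (G * G) := [set p | gmul (ginv p.1) p.1 = gmul p.2 (ginv p.2)].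
have cG2 : closed G2.
  rewrite -[G2]setCK; apply: open_closedC; rewrite openE => -[a b] /= ab.
  have := groupoid_hausdorff (s := G); rewrite open_hausdorff.
  move=> /(_ (gsource a) (grange b)) []; first exact/eqP.
  move=> [U W] /= [/set_mem Ua /set_mem Wb] [oU oW UW].
  exists (gsource @^-1` U, grange @^-1` W) => /=.
    split; [apply: (@gsource_continuous G a)|apply: (@grange_continuous G b)];
    exact: open_nbhs_nbhs.
  move=> [c d] /= [Uc Wd] cd.
  have : (U `&` W) (gsource c) by split => //; rewrite /gsource cd.
  by rewrite (eqP UW).
have cM : compact ((fun p : G * G => gmul p.1 p.2) @`
    (([set a | f a != 0] `*` [set a | g a != 0]) `&` G2)).
  apply: continuous_compact.
    by apply: continuous_subspaceW gmul_continuous => p [].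
  by apply: compact_closedI => //; exact: compact_setX.
apply: subclosed_compact cM _; first exact: (locally_constant_supp lc).2.
move=> a /= ca; apply: contrapT => na; move/eqP: ca; apply.
rewrite (@convolutionE set0) ?fsbig_set0// => b ba fb gb.
apply: na; have bVa : gsource (ginv b) = grange a by rewrite gsourceV.
exists (b, gmul (ginv b) a) => /=; last first.
  exact: gmulVKl.
split => //; rewrite /G2/= -/(gsource _) -/(grange _) grangeM//.
by rewrite grangeV.
Qed.

Lemma convolutionA f g h :
  f \in steinberg_pred -> g \in steinberg_pred -> h \in steinberg_pred ->
  convolution f (convolution g h) = convolution (convolution f g) h.
Proof.
move=> fP gP hP; apply/funext => a.
have [lh ch] := (steinbergP h).1 hP.
pose X : set G := [set b | f b != 0 /\ grange b = grange a].
have finX : finite_set X by exact: finite_supp_range.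
pose Z : set G := [set c | grange c = grange a /\ h (gmul (ginv c) a) != 0].
have finZ : finite_set Z.
  have finS := finite_source_fibre (gsource a) ch.
  apply: sub_finite_set (finite_image (fun d => gmul a (ginv d)) finS).
  move=> c [ca hc]; have cVa : gsource (ginv c) = grange a by rewrite gsourceV.
  have cVaP := gsourceM cVa.
  exists (gmul (ginv c) a) => //.
  pose d := gmul (ginv c) a.
  have cd : gsource c = grange d by rewrite grangeM// grangeV.
  rewrite -/d; have -> : gmul a (ginv d) = gmul (gmul c d) (ginv d).
    by rewrite gmulVKl.
  exact: gmulVK.
transitivity (\sum_(b \in X) \sum_(c \in Z)
    f b * (g (gmul (ginv b) c) * h (gmul (ginv c) a))).
  rewrite (@convolutionE X); first last.
  - by move=> b ba fb _.
  - by move=> b [].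
  apply: eq_fsbigr => b /set_mem[fb ba]; rewrite -mulr_fsumr; congr (_ * _).
  have bVa : gsource (ginv b) = grange a by rewrite gsourceV.
  rewrite /convolution grangeM// grangeV.
  rewrite (@reindex_fsbig _ _ _ _ _ (gmul (ginv b)) [set c | grange c = grange a]).
    transitivity (\sum_(c \in [set c | grange c = grange a])
        g (gmul (ginv b) c) * h (gmul (ginv c) a)).
      apply: eq_fsbigr => c /set_mem/= ca; congr (_ * h _).
      have bVc : gsource (ginv b) = grange c by rewrite gsourceV ca.
      rewrite ginvM// ginvK -[LHS](@gmulA _ (ginv c) b (gmul (ginv b) a)).
      - by rewrite gmulVKl.
      - by rewrite -/(gsource _) -/(grange _) gsourceV ca ba.
      - by rewrite -/(gsource _) -/(grange _) grangeM// grangeV.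
    apply/esym/fsbig_widen => [c []//|c [/= ca nZ]].
    apply/eqP; rewrite mulf_eq0; apply/orP; right.
    by apply: contra_notT nZ.
  split=> [c /= ca|c d /set_mem/= ca /set_mem/= da cd|d /= db].
  - by rewrite grangeM ?grangeV// gsourceV ca.
  - by rewrite -(gmulVKl (b := c) (etrans ba (esym ca))) cd gmulVKl// da.
  - exists (gmul b d); first by rewrite grangeM.
    exact: gmulK.
rewrite exchange_fsbig// (@convolutionE Z); first last.
- by move=> c ca _ hc.
- by move=> c [].
apply: eq_fsbigr => c /set_mem[ca hc].
rewrite (@convolutionE X).
- by rewrite mulr_fsuml; apply: eq_fsbigr => b _; rewrite mulrA.
- by move=> b [_ ba] /=; rewrite ba ca.
- by move=> b bc fb _; split => //; rewrite bc.
Qed.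

End AmpleHausdorff.
Arguments steinberg_pred : clear implicits.

HB.instance Definition _ (G : ampleHausdorffGroupoidType) (K : fieldType) :=
  GRing.isSubmodClosed.Build K (G -> K^o) (steinberg_pred G K)
    (@steinberg_submod_closed G K).

(* [K^o] is K seen as a vector space over itself. *)
Record steinberg (K : fieldType) (G : ampleHausdorffGroupoidType) := Steinberg {
  steinberg_fun :> G -> K^o ;
  _ : steinberg_fun \in steinberg_pred G K
}.

Section SteinbergAlgebra.
Context {K : fieldType} {G : ampleHausdorffGroupoidType}.
Local Notation A := (steinberg K G).

HB.instance Definition _ := [isSub for @steinberg_fun K G].
HB.instance Definition _ := [Choice of A by <:].
HB.instance Definition _ := [SubChoice_isSubLmodule of A by <:].

Lemma steinberg_mem (f : A) : (f : G -> K) \in steinberg_pred G K.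
Proof. exact: valP. Qed.

Definition steinberg_mul (f g : A) : A :=
  Steinberg (steinberg_convolution (steinberg_mem f) (steinberg_mem g)).

Lemma steinberg_mulA : associative steinberg_mul.
Proof.
move=> f g h; apply: val_inj => /=; apply: convolutionA; exact: steinberg_mem.
Qed.

Lemma steinberg_mulDl : left_distributive steinberg_mul +%R.
Proof.
move=> f g h; apply: val_inj => /=; apply: convolutionDl; exact: steinberg_mem.
Qed.

Lemma steinberg_mulDr : right_distributive steinberg_mul +%R.
Proof.
move=> f g h; apply: val_inj => /=; apply: convolutionDr; exact: steinberg_mem.
Qed.

HB.instance Definition _ := Zmodule_isNonUnitalRing.Build A
  steinberg_mulA steinberg_mulDl steinberg_mulDr.

Lemma steinberg_scalerAl (k : K) (f g : A) : k *: nmul f g = nmul (k *: f) g.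
Proof. by apply: val_inj; rewrite /= convolutionZl. Qed.

Lemma steinberg_scalerAr (k : K) (f g : A) : k *: nmul f g = nmul f (k *: g).
Proof. by apply: val_inj; rewrite /= convolutionZr. Qed.

End SteinbergAlgebra.

(* Main.v *)
From HB Require Import structures.
Require Import Defs.
From mathcomp Require Import all_boot all_algebra.
From mathcomp Require Import all_classical topology.

(** Write p ≾ f when p = x f y, and 1_W for the indicator of a compact open set
    W of units. For a compact open V, the sets W with 1_V ⊕ 1_W ≾ 1_V have as
    union an open invariant set U, every compact open subset of which is again
    such a W. If V had a point outside U, a bisection B contracting in the
    reduction to the complement D of U would lift to G, and the part of r(B)
    outside s(B) would also be such a W although it meets D. So V lies in U, and
    1_V is properly infinite.
    Proper infiniteness makes the family of all W with 1_W ≾ f closed under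
    disjoint unions. Let U now be the union of this family. If f were nonzero
    over the complement D of U, effectiveness of the reduction to D would
    provide, as in the Cuntz-Krieger uniqueness theorem, a member of the family
    meeting D. So U contains the range R of the support of f, and
    f ⊕ f ≾ 1_R ⊕ 1_R ≾ 1_R ≾ f because f = 1_R f. *)

Set Implicit Arguments.
Unset Strict Implicit.
Unset Printing Implicit Defensive.

Import GRing.Theory.

Local Open Scope classical_set_scope.

(** * Compactness through finite subcovers and in subspaces *)

Lemma compact_finite_subcover (X : topologicalType) (P : set (set X)) (A : set X) :
  compact A -> P `<=` open -> A `<=` \bigcup_(B in P) B ->
  exists2 Bs : seq (set X), {subset Bs <= P} & A `<=` \bigcup_(B in [set` Bs]) B.
Proof.
move=> cA oP AP.
have [[x Ax]|/set0P/negP/negPn/eqP->] := pselect (A !=set0); last by exists [::].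
(* A point of [A] turns [X] into a pointed space, where compactness is the covering property
   [cover_compact]. *)
pose T : ptopologicalType :=
  HB.pack (Topological.sort X) (isPointed.Build X x).
have := cA; rewrite [compact A](_ : _ = @cover_compact T A); last first.
  by rewrite -compact_cover.
move=> /(_ _ P id oP AP)[D DP AD].
exists (finmap.enum_fset D) => [B /DP//|a /AD [B DB Ba]].
by exists B.
Qed.

(** A filter on [A] pushed forward along [val] has a cluster point in the image of [A]; it clusters
    in the subspace too, because open sets there are traces of open sets of [X]. *)
Lemma compact_set_type (X : topologicalType) (S : set X) (A : set (set_type S)) :
  compact (val @` A) -> compact A.
Proof.
move=> cA F PF FA.
have FA' : (val @ F) (val @` A).
  by apply: (@filterS _ F _ A) => // x ?; exists x.
have [_ [[a Aa <-] clF]] := cA _ (fmap_proper_filter _ PF) FA'.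
exists a; split=> // B N FB.
rewrite nbhsE => -[_ [[W oW <-] Wa] WN].
have FB' : (val @ F) (val @` B).
  by apply: (@filterS _ F _ B) => // x ?; exists x.
have [_ [[x Bx <-] Wx]] := clF _ W FB' (open_nbhs_nbhs (conj oW Wa)).
by exists x; split => //; exact: WN.
Qed.

(** * Ranges, sources and units *)

Section GroupoidAlgebra.
Context {G : topGroupoidType}.
Implicit Types (a b c u : G).

Lemma grangeK a : grange (grange a) = grange a.
Proof. by rewrite {2}/grange grangeM// grangeV. Qed.

Lemma gsource_range a : gsource (grange a) = grange a.
Proof. by rewrite {2}/grange gsourceM ?grangeV// gsourceV. Qed.

Lemma grange_source a : grange (gsource a) = gsource a.
Proof. by rewrite -[gsource a]grangeV grangeK. Qed.

Lemma grange_mulK a : gmul (grange a) a = a.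
Proof. by have := @gmulVK G a (ginv a) (esym (grangeV a)); rewrite ginvK. Qed.

Lemma gmul_sourceK a : gmul a (gsource a) = a.
Proof. exact: gmulVKl. Qed.

Lemma unitsP u : units G u <-> grange u = u.
Proof.
split=> [[a _ <-]|ru]; first exact: grange_source.
by exists u => //; rewrite -ru gsource_range.
Qed.

Lemma grange_unit u : units G u -> grange u = u.
Proof. by move/unitsP. Qed.

Lemma gsource_unit u : units G u -> gsource u = u.
Proof. by move/unitsP => <-; rewrite gsource_range. Qed.

Lemma units_range a : units G (grange a).
Proof. exact/unitsP/grangeK. Qed.

Lemma units_source a : units G (gsource a).
Proof. by exists a. Qed.

Lemma ginv_unit u : units G u -> ginv u = u.
Proof.
by case=> a _ <-; rewrite {1}/gsource ginvM ?ginvK// gsourceV.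
Qed.

Lemma ginvariant_range (U : set G) a :
  ginvariant U -> U (gsource a) <-> U (grange a).
Proof.
move=> iU; split; first exact: iU.2.
by rewrite -gsourceV => /iU.2; rewrite grangeV.
Qed.

End GroupoidAlgebra.

(* A compact open subset is a bisection in the sense of [bisection] as soon as
   r and s are injective on it, because r and s are then open maps. *)
Definition compact_open_bisection {G : topGroupoidType} (C : set G) :=
  [/\ compact C, open C,
    (forall a b, C a -> C b -> grange a = grange b -> a = b) &
    (forall a b, C a -> C b -> gsource a = gsource b -> a = b)].

(** * Topology of an ample Hausdorff groupoid *)

Section AmpleTopology.
Context {G : ampleHausdorffGroupoidType}.
Implicit Types (a b c u : G) (A B C W U V : set G).

Let rcont : continuous (grange : G -> G) := @grange_continuous G.
Let scont : continuous (gsource : G -> G) := @gsource_continuous G.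

Lemma compact_openD A B : compact A -> open B -> compact (A `\` B).
Proof. by move=> cA oB; apply: compact_closedI => //; exact: open_closedC. Qed.

Lemma openDc A B : open A -> compact B -> open (A `\` B).
Proof.
move=> oA cB; apply: openI => //; apply: closed_openC.
exact: compact_closed groupoid_hausdorff cB.
Qed.

Lemma compactIc A B : compact A -> compact B -> compact (A `&` B).
Proof.
move=> cA cB; apply: compact_closedI => //.
exact: compact_closed groupoid_hausdorff cB.
Qed.

Lemma compact_range A : compact A -> compact (grange @` A).
Proof. by move=> cA; apply: continuous_compact => //; exact: continuous_subspaceT. Qed.

Lemma compact_source A : compact A -> compact (gsource @` A).
Proof. by move=> cA; apply: continuous_compact => //; exact: continuous_subspaceT. Qed.

Lemma compact_inv A : compact A -> compact (ginv @^-1` A).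
Proof.
move=> cA; rewrite (_ : _ @^-1` _ = ginv @` A).
  apply: continuous_compact => //; apply: continuous_subspaceT.
  exact: ginv_continuous.
apply/seteqP; split=> [a Aa|_ [a Aa <-]]; first by exists (ginv a) => //; rewrite ginvK.
by rewrite /= ginvK.
Qed.

Lemma open_inv A : open A -> open (ginv @^-1` A).
Proof. by move=> oA; apply: open_comp => // a _; exact: ginv_continuous. Qed.

Lemma open_preim_range A : open A -> open (grange @^-1` A).
Proof. by move=> oA; apply: open_comp => // a _; exact: rcont. Qed.

Lemma open_preim_source A : open A -> open (gsource @^-1` A).
Proof. by move=> oA; apply: open_comp => // a _; exact: scont. Qed.

Lemma bisection_compact_open B : compact B -> bisection B -> compact_open_bisection B.
Proof.
move=> cB bB; split=> //; first by case: bB.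
- by move=> a b Ba Bb; apply: (bisection_range_inj bB); rewrite inE.
- by move=> a b Ba Bb; apply: (bisection_source_inj bB); rewrite inE.
Qed.

Lemma nbhs_bisection a A : nbhs a A ->
  exists B, [/\ compact B, bisection B, B a & B `<=` A].
Proof.
move=> nA; have [Bs [_ Bsb] BsP] := ampleP (s := G).
have [B [BB Ba] BA] := Bsb a A nA.
by exists B; have [] := BsP B BB.
Qed.

Lemma nbhs_compact_open_bisection a A : nbhs a A ->
  exists B, [/\ compact_open_bisection B, B a & B `<=` A].
Proof.
move=> /nbhs_bisection[B [cB bB Ba BA]].
by exists B; split=> //; exact: bisection_compact_open.
Qed.

(** Let [B] be a bisection around a unit. For [a] close to this unit, [a] and [grange a] both lie in
    [B] and have the same range, so they coincide. *)
Lemma units_open : open (units G).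
Proof.
rewrite openE => u uu; have ru := grange_unit uu.
have [B [[cB oB Br _] Bu _]] := @nbhs_compact_open_bisection u setT filterT.
have nB : nbhs u B by exact: open_nbhs_nbhs.
have : nbhs u (grange @^-1` B) by apply: rcont; rewrite ru.
apply: filterS2 nB => a Ba Bra; apply/unitsP.
by apply: Br => //; exact: grangeK.
Qed.

(** The units are the fixed points of the continuous map [grange], and the space is Hausdorff. *)
Lemma units_closed : closed (units G).
Proof.
rewrite (_ : units G = [set a | grange a = a]); last first.
  by apply/seteqP; split => a /unitsP.
rewrite -[X in closed X]setCK; apply: open_closedC; rewrite openE => a /= ra.
have := groupoid_hausdorff (s := G); rewrite open_hausdorff.
move=> /(_ (grange a) a) []; first exact/eqP.
move=> [U W] /= [/set_mem Ua /set_mem Wb] [oU oW UW].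
have nU : nbhs a (grange @^-1` U) by apply: rcont; exact: open_nbhs_nbhs.
have nW : nbhs a W by exact: open_nbhs_nbhs.
apply: filterS2 nU nW => b Ub Wb' rb.
have : (U `&` W) b by split => //; rewrite -rb.
by rewrite (eqP UW).
Qed.

(** On each basic bisection [grange] has an image relatively open in the units, and the units are
    open. *)
Lemma open_range A : open A -> open (grange @` A).
Proof.
move=> oA; rewrite openE => _ [a Aa <-].
have [B [cB bB Ba BA]] := nbhs_bisection (open_nbhs_nbhs (conj oA Aa)).
have [_ [U [Uu /open_subspaceP[O oO OU]] [t [BU _ _ _]]] _] := bB.
have : nbhs (grange a) (O `&` units G).
  apply: open_nbhs_nbhs; split; first by apply: openI => //; exact: units_open.
  by rewrite OU -BU; split; [exists a|exact: units_range].
apply: filterS => u; rewrite OU -BU => -[[b Bb <-] _].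
by exists b => //; exact: BA.
Qed.

Lemma source_imageE A : gsource @` A = grange @` (ginv @^-1` A).
Proof.
apply/seteqP; split=> [_ [a Aa <-]|_ [a Aa <-]]; exists (ginv a) => //=.
- by rewrite ginvK.
- exact: grangeV.
- exact: gsourceV.
Qed.

Lemma open_source A : open A -> open (gsource @` A).
Proof. by move=> oA; rewrite source_imageE; apply: open_range; exact: open_inv. Qed.

Lemma compact_open_bisectionI C A : compact_open_bisection C ->
  compact (C `&` A) -> open (C `&` A) -> compact_open_bisection (C `&` A).
Proof.
by move=> [_ _ rC sC] cA oA; split=> // a b [Ca _] [Cb _]; [exact: rC|exact: sC].
Qed.

Lemma compact_open_bisection_units W : compact W -> open W -> W `<=` units G ->
  compact_open_bisection W.
Proof.
move=> cW oW Wu; split=> // a b /Wu ua /Wu ub.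
- by rewrite !grange_unit.
- by rewrite !gsource_unit.
Qed.

Lemma compact_open_bisection_inv C : compact_open_bisection C ->
  compact_open_bisection (ginv @^-1` C).
Proof.
move=> [cC oC rC sC]; split; [exact: compact_inv|exact: open_inv| |].
- move=> a b Ca Cb ab; apply: (can_inj ginvK); apply: sC => //.
  by rewrite !gsourceV.
- move=> a b Ca Cb ab; apply: (can_inj ginvK); apply: rC => //.
  by rewrite !grangeV.
Qed.

Lemma range_units_image W : W `<=` units G -> grange @` W = W.
Proof.
move=> Wu; apply/seteqP; split=> [_ [a Wa <-]|a Wa].
  by rewrite grange_unit//; exact: Wu.
by exists a => //; exact/grange_unit/Wu.
Qed.

Lemma source_units_image W : W `<=` units G -> gsource @` W = W.
Proof.
move=> Wu; apply/seteqP; split=> [_ [a Wa <-]|a Wa].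
  by rewrite gsource_unit//; exact: Wu.
by exists a => //; exact/gsource_unit/Wu.
Qed.

End AmpleTopology.

(** * Families of sets of units stable under bisections and disjoint unions *)

Definition range_closed_family {G : topGroupoidType} (P : set (set G)) :=
  [/\ forall W, P W -> [/\ compact W, open W & W `<=` units G],
      P set0,
      forall C W, compact_open_bisection C -> P W -> gsource @` C `<=` W ->
        P (grange @` C) &
      forall A B, P A -> P B -> A `&` B = set0 -> P (A `|` B)].

Section RangeClosedFamily.
Context {G : ampleHausdorffGroupoidType} (P : set (set G)).
Hypothesis PP : range_closed_family P.
Implicit Types (A B C K W : set G).

(** A compact open set of units is a bisection equal to its own source and range, so stability under
    bisections already covers passing to a smaller set. *)
Lemma range_closed_sub K W : compact K -> open K -> P W -> K `<=` W -> P K.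
Proof.
have [PW _ PC _] := PP => cK oK WP KW.
have [_ _ Wu] := PW _ WP; have Ku := subset_trans KW Wu.
rewrite -(range_units_image Ku); apply: PC WP _.
  exact: compact_open_bisection_units.
by rewrite source_units_image.
Qed.

Lemma range_closed_setU A B : P A -> P B -> P (A `|` B).
Proof.
have [PW _ _ PU] := PP => AP BP.
have [[cA oA _] [cB oB _]] := (PW _ AP, PW _ BP).
rewrite -(setDUK (@subsetUl _ A B)) setDUD setDv set0U.
apply: PU => //; last exact: setDIK.
apply: (@range_closed_sub _ B) => //; first exact: compact_openD.
exact: openDc.
Qed.

Lemma range_closed_compact K : compact K -> open K -> K `<=` \bigcup_(W in P) W ->
  P K.
Proof.
have [PW P0 _ _] := PP => cK oK KP.
have Po : P `<=` open by move=> W /PW[].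
have [Bs BsP KBs] := compact_finite_subcover cK Po KP.
apply: (range_closed_sub cK oK _ KBs).
elim: Bs BsP {KBs} => [_|B Bs IH BsP].
  by rewrite set_nil bigcup_set0.
have -> : [set` B :: Bs] = B |` [set` Bs].
  by apply/seteqP; split=> W /=; rewrite inE => /predU1P.
rewrite bigcup_setU1; apply: range_closed_setU.
  by apply/set_mem/BsP; exact: mem_head.
by apply: IH => W WBs; apply: BsP; rewrite inE WBs orbT.
Qed.

Lemma range_closed_open : open (\bigcup_(W in P) W).
Proof. by have [PW _ _ _] := PP; apply: bigcup_open => W /PW[]. Qed.

(** If [gsource a] lies in a member [W], a small bisection around [a] has its source inside [W]; its
    range is a member containing [grange a]. *)
Lemma range_closed_invariant : ginvariant (\bigcup_(W in P) W).
Proof.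
have [PW _ PC _] := PP; split=> [u [W /PW[_ _ Wu]]|a [W WP Wa]]; first exact: Wu.
have [_ oW _] := PW _ WP.
have [|C [cC Ca CW]] := @nbhs_compact_open_bisection _ a (gsource @^-1` W).
  by apply: open_nbhs_nbhs; split => //; exact: open_preim_source.
exists (grange @` C); last by exists a.
by apply: PC WP _ => // _ [c /CW Wc <-].
Qed.

End RangeClosedFamily.

(** * Effectiveness and contraction of a reduction, read in the whole groupoid *)

Section ReductionTransfer.
Context {G : ampleHausdorffGroupoidType} {V : set G} (iV : ginvariant V).
Local Notation H := (reduction iV).

Lemma reduction_gsource (a : H) : val (gsource a) = gsource (val a).
Proof. exact: val_reduction_source. Qed.

Lemma reduction_grange (a : H) : val (grange a) = grange (val a).
Proof. exact: val_reduction_range. Qed.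

Lemma reduction_units (a : H) : units H a <-> units G (val a).
Proof.
rewrite !unitsP -reduction_grange; split=> [->//|]; exact: val_inj.
Qed.

Lemma val_reduction_image (C : set G) :
  [set val a | a in (val : H -> G) @^-1` C] = C `&` gsource @^-1` V.
Proof.
apply/seteqP; split=> [_ [a Ca <-]|a [Ca Va]].
  by split=> //; exact: reductionP.
have aV : a \in gsource @^-1` V by rewrite inE.
by exists (exist _ a aV).
Qed.

(** The trace of [O] is open in the reduction, hence inside the interior of its isotropy, which
    effectiveness identifies with the units. *)
Lemma effective_reduction_units (O : set G) : effective H -> open O ->
  O `&` gsource @^-1` V `<=` [set a | gsource a = grange a] ->
  O `&` gsource @^-1` V `<=` units G.
Proof.
move=> eH oO OI a; rewrite -val_reduction_image => -[b Ob <-].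
apply/reduction_units; rewrite -eH.
rewrite /interior nbhsE; exists ((val : H -> G) @^-1` O).
  by split => //; apply: open_comp => // ? _; exact: val_reduction_continuous.
move=> c Oc; apply: val_inj; rewrite reduction_gsource reduction_grange.
by apply: OI; split => //; exact: reductionP.
Qed.

(** The contracting bisection of the reduction is the trace of an open [O]. Strictness of the
    inclusion becomes an element [b] whose range is no source. *)
Lemma contracting_reduction (W : set G) : closed V -> locally_contracting H ->
  compact W -> open W -> W `<=` units G -> W `&` V !=set0 ->
  exists O : set G, let B := O `&` gsource @^-1` V in
    [/\ open O, compact B,
      (forall a b, B a -> B b -> grange a = grange b -> a = b) &
      (forall a b, B a -> B b -> gsource a = gsource b -> a = b)] /\
    [/\ grange @` B `<=` W, gsource @` B `<=` grange @` B &
      exists2 b, B b & ~ (gsource @` B) (grange b)].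
Proof.
move=> cV lH cW oW Wu [v [Wv Vv]].
have sv := gsource_unit (Wu _ Wv).
have vV : v \in gsource @^-1` V by rewrite inE /= sv.
have [||| B [cB bB [sB nsB] rB]] := lH ((val : H -> G) @^-1` W).
- by exists (exist _ v vV).
- apply: compact_set_type; rewrite val_reduction_image.
  apply: compact_closedI => //; apply: (closed_comp _ cV) => // a _.
  exact: gsource_continuous.
- split=> [a Wa|]; first by apply/reduction_units; exact: Wu.
  apply: open_subspaceW.
  by apply: open_comp => // ? _; exact: val_reduction_continuous.
have [[O oO OB] [U1 _ [g1 [_ g1K _ _]]] [U2 _ [g2 [_ g2K _ _]]]] := bB.
have BE : [set val a | a in B] = O `&` gsource @^-1` V.
  by rewrite -OB -val_reduction_image.
exists O; cbv zeta; rewrite -BE.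
have rinj : {in B &, injective (grange : H -> H)} := can_in_inj g1K.
have sinj : {in B &, injective (gsource : H -> H)} := can_in_inj g2K.
split; split.
- by [].
- apply: continuous_compact => //; apply: continuous_subspaceT.
  exact: val_reduction_continuous.
- move=> _ _ [a Ba <-] [b Bb <-]; rewrite -!reduction_grange => /val_inj ab.
  by rewrite (rinj a b) ?inE.
- move=> _ _ [a Ba <-] [b Bb <-]; rewrite -!reduction_gsource => /val_inj ab.
  by rewrite (sinj a b) ?inE.
- move=> _ [_ [a Ba <-] <-]; rewrite -reduction_grange.
  by apply: (rB (grange a)); exists a.
- move=> _ [_ [a Ba <-] <-]; rewrite -reduction_gsource.
  have [|b Bb <-] := sB (gsource a); first by exists a.
  by rewrite reduction_grange; exists (val b) => //; exists b.
- apply: contra_notP nsB => nb _ [b Bb <-].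
  apply: contrapT => nsb; apply: nb; exists (val b); first by exists b.
  move=> [_ [a Ba <-]]; rewrite -reduction_gsource -reduction_grange => /val_inj ab.
  by apply: nsb; exists a.
Qed.

End ReductionTransfer.

(** * Lifting compact open bisections from a reduction *)

Section LiftBisection.
Context {G : ampleHausdorffGroupoidType}.
Implicit Types (A B C O V : set G).

Lemma open_preim_rangeC C : compact C -> open (~` (grange @^-1` (grange @` C))).
Proof.
move=> cC; rewrite preimage_setC; apply: open_preim_range; apply: closed_openC.
exact: compact_closed groupoid_hausdorff (compact_range cC).
Qed.

Lemma open_preim_sourceC C : compact C -> open (~` (gsource @^-1` (gsource @` C))).
Proof.
move=> cC; rewrite preimage_setC; apply: open_preim_source; apply: closed_openC.
exact: compact_closed groupoid_hausdorff (compact_source cC).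
Qed.

(* A compact open bisection of the reduction to V is the trace of one of G:
   cover it by bisections of G and adjoin them one by one, discarding the part
   whose range or source is already taken, which does not meet s^-1(V). *)
Lemma lift_bisection V O : ginvariant V -> open O ->
  let C := O `&` gsource @^-1` V in compact C ->
  (forall a b, C a -> C b -> grange a = grange b -> a = b) ->
  (forall a b, C a -> C b -> gsource a = gsource b -> a = b) ->
  exists2 B, compact_open_bisection B & B `&` gsource @^-1` V = C.
Proof.
move=> iV oO C cC rC sC.
(* Staying inside [O] keeps the trace of the lift from exceeding [C]. *)
pose P : set (set G) := [set B | compact_open_bisection B /\ B `<=` O].
have Po : P `<=` open by move=> B [[]].
have [|Bs BsP CBs] := compact_finite_subcover cC Po.
  move=> a [Oa _].
  have [B [cB Ba BO]] := nbhs_compact_open_bisection (open_nbhs_nbhs (conj oO Oa)).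
  by exists B.
suff [B [cB BO BsB]] : exists B, [/\ compact_open_bisection B, B `<=` O &
    \bigcup_(A in [set` Bs]) A `&` gsource @^-1` V `<=` B].
  exists B => //; apply/seteqP; split=> a [Ba Va]; split => //; first exact: BO.
  by apply: BsB; split => //; apply: CBs.
elim: Bs BsP {CBs} => [_|B Bs IH BsP].
  exists set0; rewrite set_nil bigcup_set0 set0I; split => //.
  by split => //; [exact: compact0|exact: open0].
have [|M [cobM MO BsM]] := IH; first by move=> A ABs; apply: BsP; rewrite inE ABs orbT.
have /set_mem[[cB oB rB sB] BO] : B \in P by exact/BsP/mem_head.
have [cM oM rM sM] := cobM.
pose N := (B `&` ~` (grange @^-1` (grange @` M))) `&`
          ~` (gsource @^-1` (gsource @` M)).
have oN : open N.
  apply: openI; last exact: open_preim_sourceC.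
  by apply: openI => //; exact: open_preim_rangeC.
have cN : compact N.
  by apply: compact_openD; [apply: compact_openD => //|];
    [exact/open_preim_range/open_range|exact/open_preim_source/open_source].
have NB : N `<=` B by move=> a [[]].
exists (M `|` N); split; first split.
- exact: compactU.
- exact: openU.
- move=> a b [Ma|Na] [Mb|Nb] ab; [exact: rM| | |by apply: rB => //; exact: NB].
    by case: Nb => -[_ nb] _; case: nb; exists a.
  by case: Na => -[_ na] _; case: na; exists b.
- move=> a b [Ma|Na] [Mb|Nb] ab; [exact: sM| | |by apply: sB => //; exact: NB].
    by case: Nb => _ nb; case: nb; exists a.
  by case: Na => _ na; case: na; exists b.
- by move=> a [/MO//|/NB/BO].
- move=> a [[A /= /predU1P[AB|ABs] Aa] Va]; last first.
    by left; apply: BsM; split => //; exists A.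
  rewrite {}AB in Aa; have Ca : C a by split=> //; exact: BO.
  (* Nothing of [C] is lost: if [m] in [M] shares its range with [a], invariance of [V] puts [m] in
     [C], and injectivity on [C] gives [m = a]. The same works for sources. *)
  have [|nr] := pselect ((grange @` M) (grange a)).
    move=> [m Mm ma]; left; rewrite -(rC m a)//; split; first exact: MO.
    by apply/(ginvariant_range _ iV); rewrite ma; apply/(ginvariant_range _ iV).
  have [|ns] := pselect ((gsource @` M) (gsource a)); last by right.
  move=> [m Mm ma]; left; rewrite -(sC m a)//; split; first exact: MO.
  by rewrite /= ma.
Qed.

End LiftBisection.

Local Open Scope ring_scope.

(** * Convolution with indicators of compact open sets *)

Section Indicator.
Context {G : ampleHausdorffGroupoidType} {K : fieldType}.
Implicit Types (a b c u : G) (A B C W : set G) (f g : steinberg K G).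

Definition indicator_fun C : G -> K^o := fun a => (a \in C)%:R.

Lemma indicator_fun_steinberg C : compact C -> open C ->
  indicator_fun C \in steinberg_pred G K.
Proof.
move=> cC oC; have clC : closed C := compact_closed groupoid_hausdorff cC.
apply/steinbergP; split=> [a|]; last first.
  rewrite (_ : [set _ | _] = C)//; apply/seteqP; split=> a.
    rewrite /= /indicator_fun.
    by case: (boolP (a \in C)) => [/set_mem//|]; rewrite eqxx.
  by move=> Ca /=; rewrite /indicator_fun mem_set// oner_eq0.
rewrite /indicator_fun; have [Ca|nCa] := pselect (C a).
  have : nbhs a C by exact: open_nbhs_nbhs.
  by apply: filterS => b Cb; rewrite !mem_set.
have : nbhs a (~` C) by apply: open_nbhs_nbhs; split => //; exact: closed_openC.
by apply: filterS => b nCb; rewrite !memNset.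
Qed.

(* Equal to 0 when C is not compact open. *)
Definition indicator C : steinberg K G := insubd 0 (indicator_fun C).

Lemma indicatorE C : compact C -> open C ->
  (indicator C : G -> K) = indicator_fun C.
Proof.
by move=> cC oC; apply: (@insubdK _ _ (steinberg K G)); exact: indicator_fun_steinberg.
Qed.

Lemma steinberg_funP f g : (forall a, f a = g a) -> f = g.
Proof. by move=> fg; apply: val_inj; exact/funext. Qed.

Lemma steinberg_addE f g a : (f + g) a = f a + g a.
Proof. by []. Qed.

Lemma indicator0 : indicator set0 = 0.
Proof.
apply: steinberg_funP => a.
by rewrite indicatorE ?/indicator_fun ?in_set0//; [exact: compact0|exact: open0].
Qed.

(** The convolution sum has a single possibly nonzero term, at the only element of [C] with the
    range of [a]. *)
Lemma indicator_mull C f a c : compact_open_bisection C ->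
  C c -> grange c = grange a -> nmul (indicator C) f a = f (gmul (ginv c) a).
Proof.
move=> [cC oC rC _] Cc ca; rewrite [LHS](@convolutionE _ _ [set c]) ?fsbig_set1//.
- by rewrite indicatorE// /indicator_fun mem_set// mul1r.
- by move=> b ->.
- move=> b ba; rewrite indicatorE// /indicator_fun.
  case: (boolP (b \in C)) => [/set_mem Cb|]; last by rewrite eqxx.
  by move=> _ _; apply: rC => //; rewrite ba.
Qed.

Lemma indicator_mull0 C f a : compact C -> open C ->
  ~ (grange @` C) (grange a) -> nmul (indicator C) f a = 0.
Proof.
move=> cC oC nCa; rewrite [LHS](@convolutionE _ _ set0) ?fsbig_set0//.
move=> b ba; rewrite indicatorE// /indicator_fun.
case: (boolP (b \in C)) => [/set_mem Cb|]; last by rewrite eqxx.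
by case: nCa; exists b.
Qed.

Lemma indicator_units_mull W f a : compact W -> open W -> W `<=` units G ->
  nmul (indicator W) f a = (grange a \in W)%:R * f a.
Proof.
move=> cW oW Wu; have [Wa|nWa] := pselect (W (grange a)).
  rewrite (indicator_mull _ (c := grange a)) ?grangeK//; last first.
    exact: compact_open_bisection_units.
  by rewrite ginv_unit ?grange_mulK ?mem_set ?mul1r//; exact: units_range.
by rewrite indicator_mull0 ?memNset ?mul0r// range_units_image.
Qed.

(** A nonzero term at [b] needs the inverse of [b] times [a] to be a unit, which forces [b = a]. *)
Lemma indicator_units_mulr W f a : compact W -> open W -> W `<=` units G ->
  nmul f (indicator W) a = f a * (gsource a \in W)%:R.
Proof.
move=> cW oW Wu; rewrite [LHS](@convolutionE _ _ [set a]) ?fsbig_set1.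
- by rewrite indicatorE.
- by move=> b ->.
- move=> b ba _; rewrite indicatorE// /indicator_fun.
  case: (boolP (_ \in W)) => [/set_mem/Wu/grange_unit|]; last by rewrite eqxx.
  rewrite grangeM ?gsourceV// grangeV => e _.
  by rewrite -(gmulVKl ba) -e gmul_sourceK.
Qed.

Lemma indicator_mul_disjoint W1 W2 : compact W1 -> open W1 -> W1 `<=` units G ->
  compact W2 -> open W2 -> W2 `<=` units G -> W1 `&` W2 = set0 ->
  nmul (indicator W1) (indicator W2) = 0.
Proof.
move=> cW1 oW1 W1u cW2 oW2 W2u W12; apply: steinberg_funP => a.
rewrite indicator_units_mull// indicatorE// /indicator_fun.
have [/set_mem W2a|] := boolP (a \in W2); last by rewrite mulr0.
rewrite memNset ?mul0r// grange_unit; last exact: W2u.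
by move=> W1a; rewrite -[False]/(set0 a) -W12.
Qed.

Lemma indicator_range_mull W C : compact W -> open W -> W `<=` units G ->
  compact C -> open C -> grange @` C `<=` W ->
  nmul (indicator W) (indicator C) = indicator C.
Proof.
move=> cW oW Wu cC oC CW; apply: steinberg_funP => a.
rewrite indicator_units_mull// indicatorE// /indicator_fun.
have [Ca|] := boolP (a \in C); last by rewrite mulr0.
by rewrite mem_set ?mul1r//; apply: CW; exists a => //; exact: set_mem.
Qed.

Lemma indicator_source_mulr W C : compact W -> open W -> W `<=` units G ->
  compact C -> open C -> gsource @` C `<=` W ->
  nmul (indicator C) (indicator W) = indicator C.
Proof.
move=> cW oW Wu cC oC CW; apply: steinberg_funP => a.
rewrite indicator_units_mulr// indicatorE// /indicator_fun.
have [Ca|] := boolP (a \in C); last by rewrite mul0r.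
by rewrite mem_set ?mulr1//; apply: CW; exists a => //; exact: set_mem.
Qed.

(** If [c] in [C] has the range of [a], the product at [a] tests whether [gmul (ginv a) c] is in
    [C]. That element has the source of [c], so it would equal [c], which means that [a] is the unit
    [grange c]. *)
Lemma indicator_mul_inv C : compact_open_bisection C ->
  nmul (indicator C) (indicator (ginv @^-1` C)) = indicator (grange @` C).
Proof.
move=> cobC; have [cC oC rC sC] := cobC; apply: steinberg_funP => a.
have [cV oV] := (compact_inv cC, open_inv oC).
have [cR oR] := (compact_range cC, open_range oC).
rewrite (indicatorE cR oR) /indicator_fun.
have [[c Cc ca]|nCa] := pselect ((grange @` C) (grange a)); last first.
  rewrite indicator_mull0// memNset//; apply: contra_not nCa => -[c Cc <-].
  by exists c => //; rewrite grangeK.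
rewrite (indicator_mull _ (c := c))// (indicatorE cV oV) /indicator_fun.
congr (_%:R); congr nat_of_bool; apply/idP/idP => /set_mem.
  rewrite /= ginvM ?gsourceV// ginvK => Cac; rewrite mem_set//.
  have ac : gmul (ginv a) c = c.
    by apply: sC => //; rewrite gsourceM// gsourceV.
  exists c => //; rewrite -[LHS](ginv_unit (units_range c)) -[RHS]ginvK; congr ginv.
  have := gmulVK (ginv a) c; rewrite ac; apply.
  by rewrite -/(gsource _) gsourceV.
move=> [d Cd da]; rewrite mem_set//=.
have cd : c = d by apply: rC; rewrite // ca -da grangeK.
rewrite -da -cd ginvM ?gsourceV ?grangeK// ginvK ginv_unit ?grange_mulK//.
exact: units_range.
Qed.

Lemma indicatorU A B : compact A -> open A -> compact B -> open B ->
  A `&` B = set0 -> indicator (A `|` B) = indicator A + indicator B.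
Proof.
move=> cA oA cB oB AB; apply: steinberg_funP => a.
rewrite steinberg_addE !indicatorE//; [|exact: compactU|exact: openU].
rewrite /indicator_fun in_setU.
case: (boolP (a \in A)) => [/set_mem Aa|_]; last by rewrite add0r.
by rewrite memNset ?addr0// => Ba; rewrite -[False]/(set0 a) -AB.
Qed.

End Indicator.

(** * Absorption and factorization in a non-unital ring *)

Section NonUnitalAlgebra.
Context {R : nonUnitalRingType}.
Implicit Types (a b c e f m p q s t w x y z : R).
Local Notation "x ** y" := (nmul x y) (at level 40, left associativity).

Lemma nmul0r x : 0 ** x = 0.
Proof. by apply: (addIr (0 ** x)); rewrite -nmulDl !add0r. Qed.

Lemma nmulr0 x : x ** 0 = 0.
Proof. by apply: (addIr (x ** 0)); rewrite -nmulDr !add0r. Qed.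

Lemma nmulNr x y : (- x) ** y = - (x ** y).
Proof. by apply: (addIr (x ** y)); rewrite -nmulDl !addNr nmul0r. Qed.

Lemma nmulrN x y : x ** (- y) = - (x ** y).
Proof. by apply: (addIr (x ** y)); rewrite -nmulDr !addNr nmulr0. Qed.

Lemma nmulBl x y z : (x - y) ** z = x ** z - y ** z.
Proof. by rewrite nmulDl nmulNr. Qed.

Lemma nmulBr x y z : x ** (y - z) = x ** y - x ** z.
Proof. by rewrite nmulDr nmulrN. Qed.

Definition factors_through f p := exists x y, x ** f ** y = p.

(* For idempotent p this is p ⊕ w ≾ p, with the matrices normalised by p. *)
Definition absorbs p w := exists s t s' t',
  [/\ s ** t = p, s' ** t' = w, s ** t' = 0 & s' ** t = 0] /\
  [/\ s ** p = s, p ** t = t, s' ** p = s' & p ** t' = t'].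

Lemma absorbs0 p : p ** p = p -> absorbs p 0.
Proof. by move=> pp; exists p, p, 0, 0; rewrite !(nmul0r, nmulr0). Qed.

(** For [x] and [y] the indicators of a bisection and of its inverse, this carries absorption from
    the source to the range. *)
Lemma absorbs_conj p w x y : absorbs p w -> absorbs p (x ** w ** y).
Proof.
move=> [s [t [s' [t' [[st s't' st' s't] [sp pt s'p pt']]]]]].
exists s, t, (x ** s'), (t' ** y); split; split=> //.
- by rewrite nmulA -(nmulA x) s't'.
- by rewrite nmulA st' nmul0r.
- by rewrite -nmulA s't nmulr0.
- by rewrite -nmulA s'p.
- by rewrite nmulA pt'.
Qed.

(** The first decomposition leaves a copy of [p] beside [w1]; the second one is applied inside that
    copy to make room for [w2]. *)
Lemma absorbsD p w1 w2 : absorbs p w1 -> absorbs p w2 -> absorbs p (w1 + w2).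
Proof.
move=> [s1 [t1 [u1 [v1 [[st1 uv1 sv1 ut1] [sp1 pt1 up1 pv1]]]]]].
move=> [s2 [t2 [u2 [v2 [[st2 uv2 sv2 ut2] [sp2 pt2 up2 pv2]]]]]].
have mid x y : x ** s1 ** (t1 ** y) = x ** p ** y by rewrite nmulA -(nmulA x) st1.
exists (s2 ** s1), (t1 ** t2), (u2 ** s1 + u1), (t1 ** v2 + v1).
split; split.
- by rewrite mid sp2.
- rewrite nmulDr !nmulDl mid up2 uv2 nmulA ut1 nmul0r addr0.
  by rewrite -nmulA sv1 nmulr0 add0r uv1 addrC.
- by rewrite nmulDr mid sp2 sv2 add0r -nmulA sv1 nmulr0.
- by rewrite nmulDl mid up2 ut2 add0r nmulA ut1 nmul0r.
- by rewrite -nmulA sp1.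
- by rewrite nmulA pt1.
- by rewrite nmulDl -nmulA sp1 up1.
- by rewrite nmulDr nmulA pt1 pv1.
Qed.

(* In terms of V = p, r(B) = b b', s(B) = m + z and w = r(B) \ s(B), with e the
   complement of r(B) in p: the bisection B moves m + z onto r(B), so that
   e + m and the copy of z absorbed by p make up p again, and w is set free. *)
Lemma absorbs_contraction p e m z w b b' :
  p ** e = e -> p ** m = m -> e ** p = e -> m ** p = m ->
  w ** p = w -> w ** w = w ->
  e ** e = e -> m ** m = m -> z ** z = z ->
  e ** m = 0 -> m ** e = 0 -> e ** w = 0 -> w ** e = 0 ->
  m ** w = 0 -> w ** m = 0 ->
  e + b ** (m + z) ** b' = p ->
  absorbs p z -> absorbs p w.
Proof.
move=> pe pm ep mp wp ww ee mm zz em me ew we mw wm ebp.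
move=> [s [t [s' [t' [[st s't' st' s't] [sp pt s'p pt']]]]]].
pose q := e + b ** m; pose q' := e + m ** b'.
have qp : q ** p = q by rewrite nmulDl ep -nmulA mp.
have pq' : p ** q' = q' by rewrite nmulDr pe nmulA pm.
have qw : q ** w = 0 by rewrite nmulDl ew -nmulA mw nmulr0 addr0.
have wq' : w ** q' = 0 by rewrite nmulDr we nmulA wm nmul0r addr0.
have qq' : q ** q' = e + b ** m ** b'.
  rewrite nmulDl !nmulDr ee nmulA em nmul0r addr0 -nmulA me nmulr0 add0r.
  by rewrite nmulA -(nmulA b) mm.
clearbody q q'.
(* The first two witnesses multiply to q q' + b z b' = e + b (m + z) b' = p. The pair w s, t w gives
   w, and the mixed products vanish since q w = 0 and w q' = 0. *)
exists (q ** s + b ** z ** s'), (t ** q' + t' ** (z ** b')).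
exists (w ** s), (t ** w).
have st_ x y : x ** s ** (t ** y) = x ** p ** y by rewrite nmulA -(nmulA x) st.
have st'_ x y : x ** s ** (t' ** y) = 0 by rewrite nmulA -(nmulA x) st' nmulr0 nmul0r.
have s't_ x y : x ** s' ** (t ** y) = 0 by rewrite nmulA -(nmulA x) s't nmulr0 nmul0r.
have s't'_ x y : x ** s' ** (t' ** y) = x ** z ** y by rewrite nmulA -(nmulA x) s't'.
split; split.
- rewrite nmulDl !nmulDr st_ st'_ s't_ s't'_ addr0 add0r qp qq'.
  rewrite -(nmulA b z z) zz nmulA -(nmulA b z z) zz -addrA -nmulDl -nmulDr.
  exact: ebp.
- by rewrite st_ wp ww.
- by rewrite nmulDl st_ s't_ qp qw addr0.
- by rewrite nmulDr st_ st'_ wp wq' addr0.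
- by rewrite nmulDl -!nmulA sp s'p.
- by rewrite nmulDr !nmulA pt pt'.
- by rewrite -nmulA sp.
- by rewrite nmulA pt.
Qed.

(** Gaussian elimination clears the cross terms but leaves q - b a in place of q. A second copy of p
    inside p supplies the missing b a. *)
Lemma factors_throughD f p q : p ** p = p -> q ** q = q -> absorbs p p ->
  factors_through f p -> factors_through f q -> factors_through f (p + q).
Proof.
move=> pp qq [s1 [t1 [s2 [t2 [[st1 st2 st12 st21] [sp1 pt1 sp2 pt2]]]]]].
move=> [x [y xfy]] [x' [y' xfy']].
pose x1 := p ** x; pose y1 := y ** p; pose x2 := q ** x'; pose y2 := y' ** q.
have p1 : x1 ** f ** y1 = p by rewrite /x1 /y1 nmulA -(nmulA p) -(nmulA p) xfy pp.
have q2 : x2 ** f ** y2 = q by rewrite /x2 /y2 nmulA -(nmulA q) -(nmulA q) xfy' qq.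
pose a := x1 ** f ** y2; pose b := x2 ** f ** y1.
have pa : p ** a = a by rewrite /a /x1 !nmulA pp.
have aq : a ** q = a by rewrite /a /y2 -!nmulA qq.
have bp : b ** p = b by rewrite /b /y1 -!nmulA pp.
have qb : q ** b = b by rewrite /b /x2 !nmulA qq.
(* Row and column operations with pivot p: they kill both cross terms and turn q into its Schur
   complement q - b a. *)
pose x3 := x2 - b ** x1; pose y3 := y2 - y1 ** a.
have e13 : x1 ** f ** y3 = 0 by rewrite nmulBr -/a nmulA p1 pa subrr.
have e31 : x3 ** f ** y1 = 0.
  by rewrite !nmulBl -(nmulA b x1) -(nmulA b) p1 bp subrr.
have e33 : x3 ** f ** y3 = q - b ** a.
  rewrite nmulBr nmulA e31 nmul0r subr0.
  by rewrite !nmulBl q2 /a !nmulA.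
have aE : q ** (q - b ** a) ** q = q - b ** a.
  by rewrite nmulBr nmulBl !qq nmulA qb -nmulA aq.
clearbody x3 y3 a b x1 y1.
(* The two copies of p yield p and b p a = b a, so the total is p + b a + (q - b a). *)
exists ((s1 + b ** s2) ** x1 + q ** x3), (y1 ** (t1 + t2 ** a) + y3 ** q).
have assoc u v w z : u ** v ** f ** (w ** z) = u ** (v ** f ** w) ** z.
  by rewrite !nmulA.
have pE : (s1 + b ** s2) ** p ** (t1 + t2 ** a) = p + b ** a.
  rewrite -nmulA (nmulDr p) (nmulA p) pt1 pt2 nmulDl !nmulDr nmulA st12 nmul0r.
  by rewrite -!(nmulA b) st21 nmulr0 (nmulA s2) st2 pa st1 addr0 add0r.
move: (s1 + b ** s2) (t1 + t2 ** a) pE => u v pE.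
rewrite 2!nmulDl 2!nmulDr !assoc p1 e13 e31 e33 !(nmulr0, nmul0r) addr0 add0r.
by rewrite pE aE -addrA (addrC q) addNKr.
Qed.


Lemma absorbs_properly_infinite f p : f != 0 -> p ** p = p -> absorbs p p ->
  factors_through f p -> p ** f = f -> properly_infinite f.
Proof.
move=> f0 pp [s1 [t1 [s2 [t2 [[st1 st2 st12 st21] [sp1 pt1 sp2 pt2]]]]]].
move=> [x [y xfy]] pf; split=> //.
(* The factors [x] and [y] turn [f] into p, the pairs [s1], [t1] and [s2], [t2] split p into two
   orthogonal copies, and the last factor [f] gives p f = f on the diagonal. *)
pose X : 'M[R]_(1 + 1, 1) := col_mx (const_mx (s1 ** x)) (const_mx (s2 ** x)).
pose Y : 'M[R]_(1, 1 + 1) :=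
  row_mx (const_mx (y ** t1 ** f)) (const_mx (y ** t2 ** f)).
have mid s t : s ** x ** f ** (y ** t ** f) = s ** p ** t ** f.
  by rewrite -xfy !nmulA.
have f11 : f = s1 ** x ** f ** (y ** t1 ** f) by rewrite mid sp1 st1 pf.
have f12 : 0 = s1 ** x ** f ** (y ** t2 ** f) by rewrite mid sp1 st12 nmul0r.
have f21 : 0 = s2 ** x ** f ** (y ** t1 ** f) by rewrite mid sp2 st21 nmul0r.
have f22 : f = s2 ** x ** f ** (y ** t2 ** f) by rewrite mid sp2 st2 pf.
exists X, Y; apply/matrixP => i j; rewrite [RHS]mxE big_ord1 [in RHS]mxE big_ord1 /X /Y.
by case: (split_ordP i) => k ->; case: (split_ordP j) => l ->;
  rewrite ?(col_mxEu, col_mxEd, row_mxEl, row_mxEr) /mxdsum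
    ?(block_mxEul, block_mxEur, block_mxEdl, block_mxEdr) !mxE.
Qed.

End NonUnitalAlgebra.

(** * Proper infiniteness of indicators of sets of units *)

Section ProperlyInfiniteUnits.
Context {G : ampleHausdorffGroupoidType} {K : fieldType}.
Implicit Types (B C U V W : set G).
Local Notation "x ** y" := (nmul x y) (at level 40, left associativity).
Local Notation "''1_' W" := (@indicator G K W)
  (at level 8, W at level 2, format "''1_' W").

Definition compact_open_units W := [/\ compact W, open W & W `<=` units G].

Lemma compact_open_unitsD V W :
  compact_open_units V -> compact_open_units W -> compact_open_units (V `\` W).
Proof.
move=> [cV oV Vu] [cW oW Wu]; split; [exact: compact_openD|exact: openDc|].
by move=> u [/Vu].
Qed.

Lemma compact_open_unitsI V W :
  compact_open_units V -> compact_open_units W -> compact_open_units (V `&` W).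
Proof.
move=> [cV oV Vu] [cW oW Wu]; split; [exact: compactIc|exact: openI|].
by move=> u [/Vu].
Qed.

Lemma compact_open_units_range C : compact C -> open C ->
  compact_open_units (grange @` C).
Proof.
move=> cC oC; split; [exact: compact_range|exact: open_range|].
by move=> _ [c _ <-]; exact: units_range.
Qed.

Lemma compact_open_units_source C : compact C -> open C ->
  compact_open_units (gsource @` C).
Proof.
move=> cC oC; split; [exact: compact_source|exact: open_source|].
by move=> _ [c _ <-]; exact: units_source.
Qed.

Lemma indicator_sub V W : compact_open_units V -> compact_open_units W ->
  V `<=` W -> '1_W ** '1_V = '1_V.
Proof.
move=> [cV oV Vu] [cW oW Wu] VW; apply: indicator_range_mull => //.
by rewrite range_units_image.
Qed.

Lemma indicator_sup V W : compact_open_units V -> compact_open_units W ->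
  V `<=` W -> '1_V ** '1_W = '1_V.
Proof.
move=> [cV oV Vu] [cW oW Wu] VW; apply: indicator_source_mulr => //.
by rewrite source_units_image.
Qed.

Lemma indicator_disj V W : compact_open_units V -> compact_open_units W ->
  V `&` W = set0 -> '1_V ** '1_W = 0.
Proof. by move=> [cV oV Vu] [cW oW Wu]; exact: indicator_mul_disjoint. Qed.

Lemma indicator_conj C W : compact_open_bisection C -> compact_open_units W ->
  gsource @` C `<=` W -> '1_C ** '1_W ** '1_(ginv @^-1` C) = '1_(grange @` C).
Proof.
move=> cobC [cW oW Wu] CW; have [cC oC _ _] := cobC.
by rewrite indicator_source_mulr// indicator_mul_inv.
Qed.

Definition absorbed V : set (set G) :=
  [set W | compact_open_units W /\ absorbs '1_V '1_W].

(** Moving a set along a bisection conjugates its indicator, and a disjoint union adds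
    indicators. *)
Lemma absorbed_family V : compact_open_units V -> range_closed_family (absorbed V).
Proof.
move=> hV; split.
- by move=> W [[]].
- split; first by split => //; [exact: compact0|exact: open0].
  by rewrite indicator0; apply: absorbs0; exact: indicator_sub.
- move=> C W cobC [hW aW] CW; have [cC oC _ _] := cobC.
  split; first exact: compact_open_units_range.
  by rewrite -(indicator_conj cobC hW CW); exact: absorbs_conj.
- move=> A B [[cA oA Au] aA] [[cB oB Bu] aB] AB; split.
    split; [exact: compactU|exact: openU|].
    by move=> u [/Au|/Bu].
  by rewrite indicatorU//; exact: absorbsD.
Qed.

(** The source of [B] may stick out of its range, as happens for a lift of a contracting bisection;
    it suffices that the excess is absorbed. *)
Lemma absorbed_contraction V B : compact_open_units V -> compact_open_bisection B ->
  grange @` B `<=` V -> absorbed V (gsource @` B `\` grange @` B) ->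
  absorbed V (grange @` B `\` gsource @` B).
Proof.
move=> hV cobB BV [hZ aZ]; have [cB oB _ _] := cobB.
have hR := compact_open_units_range cB oB.
have hS := compact_open_units_source cB oB.
have hW := compact_open_unitsD hR hS.
have hM := compact_open_unitsI hR hS.
have hE := compact_open_unitsD hV hR.
split => //; set R := grange @` B in BV hZ aZ hR hW hM hE *.
set S := gsource @` B in hS hZ aZ hW hM *.
have MV : R `&` S `<=` V by move=> u [/BV].
have WV : R `\` S `<=` V by move=> u [/BV].
have EV : V `\` R `<=` V by move=> u [].
apply: (@absorbs_contraction _ '1_V '1_(V `\` R) '1_(R `&` S) '1_(S `\` R) '1_(R `\` S)
   '1_B '1_(ginv @^-1` B)) => //.
1-9: by first [apply: indicator_sub|apply: indicator_sup].
1-6: by apply: indicator_disj => //; apply/seteqP; split => // u /= [[? ?] [? ?]].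
have [[cM oM _] [cZ oZ _] [cE oE _] [cR oR _]] := And4 hM hZ hE hR.
have -> : '1_(R `&` S) + '1_(S `\` R) = '1_S.
  rewrite -indicatorU//; first by rewrite setIC setUIDK.
  by apply/seteqP; split => // u /= [[? ?] [? ?]].
rewrite indicator_conj// -/R -indicatorU//.
  by rewrite setUC setDUK.
by apply/seteqP; split => // u /= [[? ?] ?].
Qed.

Hypothesis contracting : forall (U : set G) (iU : ginvariant U),
  open_in (units G) U -> locally_contracting (reduction (ginvariant_setD iU)).

Lemma indicator_absorbs V : compact_open_units V -> absorbs '1_V '1_V.
Proof.
move=> hV; have fV := absorbed_family hV; have [cV oV Vu] := hV.
pose U := \bigcup_(W in absorbed V) W.
have iU : ginvariant U := range_closed_invariant fV.
have oU : open U := range_closed_open fV.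
have iD := ginvariant_setD iU.
have cD : closed (units G `\` U).
  by apply: closedI; [exact: units_closed|exact: open_closedC].
have [VU|] := pselect (V `<=` U).
  by have [] := range_closed_compact fV cV oV VU.
move=> /existsNP[v /not_implyP[Vv nUv]]; exfalso.
have oUu : open_in (units G) U by split; [exact: iU.1|exact: open_subspaceW].
have VD : V `&` (units G `\` U) !=set0 by exists v; split=> //; split=> //; exact: Vu.
have [O /= [[oO cC rC sC] [CV sr [b Cb nsb]]]] :=
  contracting_reduction cD (@contracting U iU oUu) cV oV Vu VD.
have [B [cB oB rB sB] BC] := lift_bisection iD oO cC rC sC.
set C := O `&` _ in cC rC sC CV sr Cb nsb BC.
have clV : closed V := compact_closed groupoid_hausdorff cV.
(* The lift may have ranges outside [V]; cutting them off keeps all of [C]. *)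
pose A := B `&` grange @^-1` V.
have cobA : compact_open_bisection A.
  apply: compact_open_bisectionI => //.
    apply: compact_closedI => //; apply: closed_comp => // a _.
    exact: grange_continuous.
  by apply: openI => //; exact: open_preim_range.
have CA : C `<=` A.
  by move=> c Cc; split; [move: Cc; rewrite -BC => -[]|apply: CV; exists c].
have AC a : A a -> (units G `\` U) (gsource a) -> C a.
  by move=> [Ba _] Da; rewrite -BC.
(* Over the complement of [U] the bisection [A] is just [C], whose sources are ranges. The excess
   therefore lies in [U], so it is absorbed. *)
have zU : gsource @` A `\` grange @` A `<=` U.
  move=> _ [[a Aa <-] nra]; apply: contrapT => nU; apply: nra.
  have Ca : C a by apply: AC => //; split => //; exact: units_source.
  have [|c Cc <-] := sr (gsource a); first by exists a.
  by exists c => //; exact: CA.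
have [cA oA _ _] := cobA.
have [cZ oZ _] := compact_open_unitsD (compact_open_units_source cA oA)
  (compact_open_units_range cA oA).
have Z := range_closed_compact fV cZ oZ zU.
have [|W aW] := absorbed_contraction hV cobA _ Z; first by move=> _ [a [_ Va] <-].
have Db : (units G `\` U) (grange b).
  by apply/(ginvariant_range _ iD); move: Cb; rewrite /C => -[].
(* The part of the range of [A] outside its source is now absorbed, hence inside [U], yet it
   contains [grange b]. *)
apply: Db.2; exists (grange @` A `\` gsource @` A) => //; split.
  by exists b => //; exact: CA.
move=> [a Aa ab]; apply: nsb; exists a => //; apply: AC => //.
by rewrite ab.
Qed.

End ProperlyInfiniteUnits.

(** * Effectiveness and Cuntz-Krieger uniqueness *)

Section EffectiveSeparation.
Context {G : ampleHausdorffGroupoidType} {D : set G} (iD : ginvariant D).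
Hypothesis effD : effective (reduction iD).
Implicit Types (a b : G) (B W : set G).

(** Either no element of [B] over [D] has its range in [W], and the range of [B] can be removed, or
    some such element moves a point and Hausdorff separation applies around it. *)
Lemma effective_separation1 B W :
  compact_open_bisection B -> B `<=` ~` units G ->
  open W -> W `&` D !=set0 ->
  exists W', [/\ open W', W' `<=` W, W' `&` D !=set0 &
    forall b, B b -> W' (grange b) -> ~ W' (gsource b)].
Proof.
move=> [cB oB rB _] Bu oW [d [Wd Dd]].
pose O := B `&` grange @^-1` W.
have oO : open O by apply: openI => //; exact: open_preim_range.
have [[b0 [Ob0 Db0]]|nb] := pselect (O `&` gsource @^-1` D !=set0); last first.
  exists (W `\` grange @` B); split.
  - by apply: openDc => //; exact: compact_range.
  - exact: subDsetl.
  - exists d; split=> //; split => // -[b Bb bd]; apply: nb; exists b.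
    split; first by split => //=; rewrite bd.
    by apply/(ginvariant_range _ iD); rewrite bd.
  - by move=> b Bb [_ nrb]; case: nrb; exists b.
(* Otherwise the trace of [O] over [D] is isotropy, so effectiveness makes [b0] a unit, which [B]
   excludes. *)
have [b [[Bb Wb] Db sr]] : exists b, [/\ O b, D (gsource b) & gsource b <> grange b].
  apply: contrapT => nsr; case: (Bu b0 Ob0.1).
  apply: (effective_reduction_units effD oO) => // a [Oa Da].
  by apply: contrapT => sra; apply: nsr; exists a.
have := groupoid_hausdorff (s := G); rewrite open_hausdorff.
move=> /(_ (grange b) (gsource b)) []; first exact/eqP/nesym.
move=> [N1 N2] /= [/set_mem N1b /set_mem N2b] [oN1 oN2 /eqP N12].
pose B' := O `&` (grange @^-1` N1 `&` gsource @^-1` N2).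
exists (grange @` B'); split.
- apply: open_range; apply: openI => //; apply: openI.
    exact: open_preim_range.
  exact: open_preim_source.
- by move=> _ [a [[_ Wa] _] <-].
- by exists (grange b); split; [exists b|apply/(ginvariant_range _ iD)].
(* Injectivity of the range on [B] gives [c = a], so the source of [c] is in [N2]; being in the new
   set as well, it would be in [N1]. *)
- move=> c Bc [a [[Ba _] [_ N2a]] ac] [a' [_ [N1a' _]] a'c].
  rewrite -[False]/(set0 (gsource c)) -N12; split; first by rewrite -a'c.
  by rewrite -(rB a c Ba Bc ac).
Qed.

(** The bisections are treated one after another, since the separation obtained for one survives
    shrinking the set. *)
Lemma effective_separation (Bs : seq (set G)) W :
  (forall B, B \in Bs -> compact_open_bisection B /\ B `<=` ~` units G) ->
  open W -> W `&` D !=set0 ->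
  exists W', [/\ open W', W' `<=` W, W' `&` D !=set0 &
    forall B b, B \in Bs -> B b -> W' (grange b) -> ~ W' (gsource b)].
Proof.
elim: Bs W => [|B Bs IH] W BsP oW WD; first by exists W; split.
have [cobB Bu] := BsP B (mem_head _ _).
have [W1 [oW1 W1W W1D W1B]] := effective_separation1 cobB Bu oW WD.
have [|W2 [oW2 W2W1 W2D W2B]] := IH W1 _ oW1 W1D.
  by move=> A ABs; apply: BsP; rewrite inE ABs orbT.
exists W2; split => //; first exact: subset_trans W1W.
move=> A b; rewrite inE => /predU1P[->|ABs]; last exact: W2B ABs.
by move=> Bb /W2W1 W1r /W2W1; exact: W1B.
Qed.

Context {K : fieldType}.
Implicit Types f g : steinberg K G.

(* Cuntz-Krieger uniqueness relative to D: translate f so that it is nonzero at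
   a unit of D, then cut it down by a W on which no other part of it is left. *)
Lemma effective_factors_through f a : f a != 0 -> D (gsource a) ->
  exists W, [/\ compact_open_units W, W `&` D !=set0 &
    factors_through f (indicator W)].
Proof.
move=> fa Da.
have [C [cobC Ca _]] := @nbhs_compact_open_bisection _ a setT filterT.
pose C' := ginv @^-1` C; have cobC' : compact_open_bisection C'.
  exact: compact_open_bisection_inv.
(* Left translation by the inverse bisection carries the value of [f] at [a] to the unit
   [gsource a]. *)
pose g := nmul (indicator C') f.
have ga : g (gsource a) = f a.
  rewrite /g (indicator_mull _ (c := ginv a)) ?ginvK ?gmul_sourceK//.
    by rewrite /C' /= ginvK.
  by rewrite grangeV grange_source.
have [lg cg] := (steinbergP g).1 (steinberg_mem g).
pose W0 := units G `&` [set u | g u = f a].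
have oW0 : open W0.
  apply: openI; first exact: units_open.
  by rewrite openE => u /= gu; apply: filterS (lg u) => v /= ->.
have W0D : W0 `&` D !=set0.
  by exists (gsource a); split => //; split => //; exact: units_source.
pose P : set (set G) := [set B | compact_open_bisection B /\ B `<=` ~` units G].
have Po : P `<=` open by move=> B [[]].
have cS : compact ([set b | g b != 0] `\` units G).
  by apply: compact_openD => //; exact: units_open.
have [|Bs BsP SBs] := compact_finite_subcover cS Po.
  move=> b [_ nub].
  have [|B [cobB Bb Bu]] := @nbhs_compact_open_bisection _ b (~` units G).
    by apply: open_nbhs_nbhs; split => //; apply: closed_openC; exact: units_closed.
  by exists B.
have [|W1 [oW1 W10 [v [W1v Dv]] W1B]] := effective_separation (Bs := Bs) _ oW0 W0D.
  by move=> B /BsP/set_mem.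
have [W [[cW oW _ _] Wv WW1]] :=
  nbhs_compact_open_bisection (open_nbhs_nbhs (conj oW1 W1v)).
have Wu : W `<=` units G by move=> w /WW1/W10[].
exists W; split=> //; first by exists v.
pose k : K := (f a)^-1.
exists (k *: nmul (indicator W) (indicator C')), (indicator W).
rewrite -!steinberg_scalerAl -(nmulA (indicator W) _ f) -/g; apply: steinberg_funP => b.
transitivity (k * nmul (nmul (indicator W) g) (indicator W) b); first by [].
rewrite indicator_units_mulr// indicator_units_mull// indicatorE// /indicator_fun.
(* At units of [W], [g] equals [f a], which [k] normalises to 1. A non-unit in the support of [g]
   lies in one of [Bs], so its range and source are not both in [W]. *)
have [ub|nub] := pselect (units G b).
  rewrite grange_unit// gsource_unit//.
  have [/set_mem Wb|_] := boolP (b \in W); last by rewrite !mulr0.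
  by rewrite (W10 b (WW1 b Wb)).2 mul1r mulr1 mulVf.
rewrite [b \in W]memNset; last by move/Wu.
have [gb|gb] := eqVneq (g b) 0; first by rewrite gb mulr0 mul0r mulr0.
have [B BBs Bb] := SBs b (conj gb nub).
have [/set_mem Wr|_] := boolP (grange b \in W); last by rewrite !mul0r mulr0.
rewrite memNset ?mulr0// => Ws.
exact: (W1B B b BBs Bb (WW1 _ Wr) (WW1 _ Ws)).
Qed.

End EffectiveSeparation.

(** * Sets whose indicator factors through f, and the conclusion *)

Section FactorsThroughFamily.
Context {G : ampleHausdorffGroupoidType} {K : fieldType} (f : steinberg K G).
Hypothesis absorbK : forall V, compact_open_units V ->
  absorbs (@indicator G K V) (indicator V).

(** Only disjoint unions need [absorbK]: elimination requires a second copy of the indicator of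
    [A]. *)
Lemma factors_through_family :
  range_closed_family [set W | compact_open_units W /\ factors_through f (indicator W)].
Proof.
split.
- by move=> W [[]].
- split; first by split => //; [exact: compact0|exact: open0].
  by exists 0, 0; rewrite indicator0 nmulr0.
- move=> C W cobC [hW [x [y xfy]]] CW; have [cC oC _ _] := cobC.
  split; first exact: compact_open_units_range.
  exists (nmul (indicator C) x), (nmul y (indicator (ginv @^-1` C))).
  by rewrite -(indicator_conj cobC hW CW) -xfy !nmulA.
- move=> A B [hA fA] [hB fB] AB; have [[cA oA Au] [cB oB Bu]] := (hA, hB).
  split; first split; [exact: compactU|exact: openU|by move=> u [/Au|/Bu]|].
  rewrite indicatorU//; apply: factors_throughD => //.
  - exact: indicator_sub.
  - exact: indicator_sub.
  - exact: absorbK.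
Qed.

End FactorsThroughFamily.

Theorem corollary3p6 (G : ampleHausdorffGroupoidType) (K : fieldType) :
  strongly_effective G ->
  (forall (U : set G) (iU : ginvariant U), open_in (units G) U ->
    locally_contracting (reduction (ginvariant_setD iU))) ->
  properly_purely_infinite (steinberg K G).
Proof.
move=> effG contrG f f0.
have absorbK V : compact_open_units V -> absorbs (@indicator G K V) (indicator V).
  exact: indicator_absorbs.
have famf := factors_through_family f absorbK.
set P := [set W | _] in famf; pose U := \bigcup_(W in P) W.
have iU : ginvariant U := range_closed_invariant famf.
have oU : open U := range_closed_open famf.
have iD := ginvariant_setD iU.
have cD : closed (units G `\` U).
  by apply: closedI; [exact: units_closed|exact: open_closedC].
have [lf cf] := (steinbergP f).1 (steinberg_mem f).
have of_ := (locally_constant_supp lf).1.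
pose R := grange @` [set a | f a != 0].
have hR : compact_open_units R by exact: compact_open_units_range.
have RU : R `<=` U.
  move=> _ [a fa <-]; apply: contrapT => nUa.
  have Da : (units G `\` U) (gsource a).
    by apply/(ginvariant_range _ iD); split => //; exact: units_range.
  (* Strong effectiveness applies because [gsource a] witnesses that the closed invariant complement
     is nonempty. *)
  have effD : effective (reduction iD).
    apply: effG; first by exists (gsource a).
    by split; [exact: subDsetl|exact: closed_subspaceW].
  have [W [hW [w [Ww [_ nUw]]] fW]] := effective_factors_through effD fa Da.
  by apply: nUw; exists W.
have [cR oR Ru] := hR.
have [_ fR] := range_closed_compact famf cR oR RU.
apply: (absorbs_properly_infinite f0 _ (absorbK _ hR) fR).
  exact: indicator_sub.
apply: steinberg_funP => a; rewrite indicator_units_mull//.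
have [->|fa] := eqVneq (f a) 0; first by rewrite mulr0.
by rewrite mem_set ?mul1r//; exists a.
Qed.
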